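(* Let $g_1,g_2$ be generators and $\phi$ a constraint function with values in $[0,\infty)$. Suppose each of $g_1,g_2,\phi$ is convex and satisfies the assumptions (A1), (A2), (A3) stated in the context, so that they depend only on $(t,z)$ (and, for the generators, on the suppressed $\omega$). Suppose that $\phi(t,z_1+z_2)\le\phi(t,z_1)+\phi(t,z_2)$ for all $z_1,z_2$, and that there are $a\in\mathbb R^d$, $b\in\mathbb R$ such that $g_i(t,z)\ge a\cdot z+b$ for $i=1,2$. The inf-convolution of $g_1$ and $g_2$ is $$g_3(t,z)=g_1\square g_2(t,z)=\inf_{y}\{g_1(t,z-y)+g_2(t,y)\}.$$ Let $\eta\in L^\infty(\mathcal F_T)$, let $(\mathcal E_t^{g_3,\phi}(\eta),\hat z_3(t),\hat C_3(t))$ be the $g_\Gamma$-solution with generator $g_3$ and terminal value $\eta$ satisfying the constraint given by $\phi$, and let $\hat z$ be a measurable process such that $\hat z(t)=\arg\min_y\{g_1(t,\hat z_3(t)-y)+g_2(t,y)\}$, $dt\times dP$-a.s. Then the following hold. (1) For any $t\in[0,T]$ and any $\xi\in L^\infty(\mathcal F_T)$, $$\mathcal E_t^{g_3,\phi}(\eta)\le\mathcal E_t^{g_1,\phi}(\eta-\xi)+\mathcal E_t^{g_2,\phi}(\xi).$$ (2) If $\phi(t,\hat z(t))=0$, $\phi(t,\hat z_3(t)-\hat z(t))=0$ and $$\xi^*:=\int_0^Tg_2(s,\hat z_s)\,ds-\int_0^T\hat z_s^*\,dW_s\in L^\infty(\mathcal F_T),$$ then $\xi^*$ is optimal for (that is,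 attains the infimum in) the problem $$\inf_{\xi\in L^\infty(\mathcal F_T)}\{\rho_1(\eta-\xi)+\rho_2(\xi)\},\qquad \rho_i(\cdot)=\mathcal E_0^{g_i,\phi}(-\,\cdot),\ i=1,2,$$ and furthermore $$\mathcal E_t^{g_3,\phi}(\eta)=\mathcal E_t^{g_1,\phi}\square\mathcal E_t^{g_2,\phi}(\eta)\quad\text{for all }t\in[0,T].$$
   Context: Fix $T>0$ and a probability space $(\Omega,\mathcal F,P)$ with an $\mathbb R^d$-valued Brownian motion $W$; $(\mathcal F_t)_{t\in[0,T]}$ is the filtration generated by $W$ augmented by the $P$-null sets. $L^2_T(\mathbb R)$ is the space of $\mathcal F_T$-measurable square-integrable real random variables; $L^\infty(\mathcal F_T)$ is the space of $P$-essentially bounded $\mathcal F_T$-measurable random variables; $H^2_T$ is the space of predictable processes $\varphi$ with $E\int_0^T|\varphi_t|^2dt<\infty$. A star on a vector denotes transpose (except in the name $\xi^*$). Assumptions on a function $h$ of $(\omega,t,y,z)$, $y\in\mathbb R$, $z\in\mathbb R^d$ (used for generators and for $\phi$): (A1) there is $M>0$ with $|h(\omega,t,y_1,z_1)-h(\omega,t,y_2,z_2)|\le M(|y_1-y_2|+|z_1-z_2|)$ for all $(y_1,z_1),(y_2,z_2)$; (A2) $h(\cdot,0,0)\in H^2_T$; (A3) $h$ is independent of $y$ and $h(\cdot,0)=0$. The variable $\omega$ is suppressed in the notation. For a generator $g$ independent of $y$, a $g$-supersolution with terminal value $\xi\in L^2_T(\mathbb R)$ is a vector process $(y_t,z_t,C_t)$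 satisfying $$y_t=\xi+\int_t^Tg(s,z_s)\,ds-\int_t^Tz_s^*\,dW_s+\int_t^TdC_s,\qquad t\in[0,T],$$ where $C$ is an increasing, adapted, right-continuous process with $C_0=0$. It satisfies the constraint if $\phi(t,z_t)=0$. The $g_\Gamma$-solution (minimal solution) with terminal value $\xi$ is the $g$-supersolution $(y,z,C)$ with $y_T=\xi$ satisfying the constraint such that $y_t\le y'_t$ a.e., a.s. for any other $g$-supersolution $(y',z',C')$ with $y'_T=\xi$ satisfying the constraint; its first component is denoted $\mathcal E_t^{g,\phi}(\xi)$. The inf-convolution at time $t$, $\mathcal E_t^{g_1,\phi}\square\mathcal E_t^{g_2,\phi}(\eta)$, is the (essential) infimum over $\xi\in L^\infty(\mathcal F_T)$ of $\mathcal E_t^{g_1,\phi}(\eta-\xi)+\mathcal E_t^{g_2,\phi}(\xi)$.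
   Formalization: In (2), ξ* is proved optimal for inf{ρ_1(−η−ξ)+ρ_2(ξ)}, with −η in place of η, because the printed sign makes the claim false (e.g. φ=0, g_1=g_2=√(1+z²)−1, η non-constant); also ẑ is taken in H²_T so that ∫ẑ*dW is defined. *)

(* Defs.v *)
From HB Require Import structures.
From mathcomp Require Import all_boot all_order all_algebra.
From mathcomp Require Import all_classical all_reals all_analysis.
Import Order.TTheory GRing.Theory Num.Theory.
Import numFieldNormedType.Exports.

Set Implicit Arguments.
Unset Strict Implicit.
Unset Printing Implicit Defensive.

Local Open Scope classical_set_scope.
Local Open Scope ring_scope.

Section Euclidean.
Context {R : realType} {n : nat}.

Definition dotv (u v : 'rV[R]_n) : R := \sum_i u 0 i * v 0 i.

(* The library norm on row vectors is the sup norm. *)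
Definition enorm (u : 'rV[R]_n) : R := Num.sqrt (dotv u u).

End Euclidean.

(* Measurability with respect to the sigma-algebra generated by [G]. *)
Definition sub_measurable {U : pointedType} {R : realType} (G : set (set U))
    (D : set U) (X : U -> R) : Prop :=
  @measurable_fun _ _ (g_sigma_algebraType G) R D X.

Section StochasticCalculus.
Context {disp : measure_display} {Omega : measurableType disp} {R : realType}.
Variables (P : probability Omega R) (T : R).

Local Notation mu := (@lebesgue_measure R).

(* dt x dP-almost everywhere on [0, T] x Omega *)
Definition dtdP_ae (Q : Omega -> R -> Prop) : Prop :=
  {ae (P \x mu)%E, forall x : Omega * R, 0 <= x.2 <= T -> Q x.1 x.2}.

Section Brownian.
Variables (d : nat) (W : Omega -> R -> 'rV[R]_d).

Definition history_gen (t : R) : set (set Omega) :=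
  [set A | exists s (i : 'I_d) (B : set R),
     [/\ 0 <= s <= t, measurable B & A = (fun w => W w s 0 i) @^-1` B]].

Definition null_events : set (set Omega) :=
  [set N | measurable N /\ P N = 0%E].

Definition filtration_gen (t : R) : set (set Omega) :=
  history_gen t `|` null_events.

(* The augmented Brownian filtration. *)
Definition filtration (t : R) : set (set Omega) := <<s filtration_gen t >>.

Definition increment_in (s t : R) (B : 'I_d -> set R) : set Omega :=
  [set w | forall i, B i ((W w t - W w s) 0 i)].

Record brownian_motion : Prop := BrownianMotion {
  bm_measurable : forall t i, 0 <= t <= T ->
    measurable_fun setT (fun w => W w t 0 i) ;
  bm_start : {ae P, forall w, W w 0 = 0} ;
  bm_continuous : {ae P, forall w, {within `[0, T], continuous (W w)}} ;
  (* [normal_prob m sigma] takes the standard deviation as its parameter *)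
  bm_gaussian : forall s t, 0 <= s -> s < t -> t <= T ->
    forall B : 'I_d -> set R, (forall i, measurable (B i)) ->
    (P (increment_in s t B) =
       \prod_(i < d) normal_prob 0%R (Num.sqrt (t - s)) (B i))%E ;
  bm_independent : forall s t, 0 <= s -> s < t -> t <= T ->
    forall B : 'I_d -> set R, (forall i, measurable (B i)) ->
    forall A, <<s history_gen s >> A ->
    (P (A `&` increment_in s t B) = P A * P (increment_in s t B))%E
}.

Definition rv_measurable (t : R) (X : Omega -> R) : Prop :=
  sub_measurable (filtration_gen t) setT X.

Definition adapted (X : Omega -> R -> R) : Prop :=
  forall t, 0 <= t <= T -> rv_measurable t (fun w => X w t).

Definition predictable_gen : set (set (Omega * R)) :=
  [set D | (exists A, filtration 0 A /\ D = A `*` [set 0]) \/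
           (exists s t A, [/\ 0 <= s, s < t, t <= T, filtration s A &
              D = A `*` [set` `]s, t]]])].

Definition predictable (X : Omega -> R -> R) : Prop :=
  sub_measurable predictable_gen (setT `*` `[0, T]) (fun x => X x.1 x.2).

Definition sq_norm {m : nat} (z : Omega -> R -> 'rV[R]_m) : \bar R :=
  (\int[P]_w \int[mu]_(t in `[0%R, T]) ((enorm (z w t)) ^+ 2)%:E)%E.

Definition H2 {m : nat} (z : Omega -> R -> 'rV[R]_m) : Prop :=
  (forall i, predictable (fun w t => z w t 0 i)) /\ (sq_norm z < +oo)%E.

Definition L2T (xi : Omega -> R) : Prop :=
  rv_measurable T xi /\ (\int[P]_w ((xi w) ^+ 2)%:E < +oo)%E.

Definition Linf (xi : Omega -> R) : Prop :=
  rv_measurable T xi /\ exists M : R, {ae P, forall w, `|xi w| <= M}.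

Definition jointly_measurable (z : Omega -> R -> 'rV[R]_d) : Prop :=
  forall i, measurable_fun (setT `*` `[0, T])
    (fun x : Omega * R => z x.1 x.2 0 i).

(** Ito integral of integrands in [H2] *)

(* The elementary integrand  (w, u) |-> step_coef w * 1_{]step_l, step_r]}(u);
   a simple process is a finite sum of such terms, given by their list (the
   intervals may overlap). *)
Record step := Step {
  step_l : R ; step_r : R ; step_coef : Omega -> 'rV[R]_d }.

Definition step_valid (e : step) : Prop :=
  [/\ 0 <= step_l e, step_l e <= step_r e, step_r e <= T,
      forall i, rv_measurable (step_l e) (fun w => step_coef e w 0 i) &
      exists M : R, forall w, enorm (step_coef e w) <= M].

Definition simple_process (S : seq step) (w : Omega) (u : R) : 'rV[R]_d :=
  \sum_(e <- S) (if step_l e < u <= step_r e then step_coef e w else 0).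

Definition simple_integral (S : seq step) (w : Omega) (u : R) : R :=
  \sum_(e <- S) dotv (step_coef e w)
    (W w (Num.min (step_r e) u) - W w (Num.min (step_l e) u)).

(* [I] is a continuous version of  t |-> \int_0^t z_s^* dW_s, the L^2-limit
   of the integrals of simple processes approximating z in [H2]. *)
Definition is_ito (z : Omega -> R -> 'rV[R]_d) (I : Omega -> R -> R) : Prop :=
  [/\ H2 z, adapted I, {ae P, forall w, {within `[0, T], continuous (I w)}} &
    exists S : nat -> seq step,
      [/\ forall k, all (fun e => `[< step_valid e >]) (S k),
          sq_norm (fun w t => simple_process (S k) w t - z w t)
            @[k --> \oo] --> 0%E &
          forall t, 0 <= t <= T ->
            (\int[P]_w ((simple_integral (S k) w t - I w t) ^+ 2)%:E)%E
              @[k --> \oo] --> 0%E]].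

(** Assumptions on coefficients h(omega, t, y, z) *)

Definition A1 (h : Omega -> R -> R -> 'rV[R]_d -> R) : Prop :=
  exists M : R, 0 < M /\
    forall w t, 0 <= t <= T -> forall y1 z1 y2 z2,
      `|h w t y1 z1 - h w t y2 z2| <= M * (`|y1 - y2| + enorm (z1 - z2)).

Definition A2 (h : Omega -> R -> R -> 'rV[R]_d -> R) : Prop :=
  H2 (fun w t => const_mx (h w t 0 0) : 'rV[R]_1).

Definition A3 (h : Omega -> R -> R -> 'rV[R]_d -> R) : Prop :=
  forall w t, 0 <= t <= T ->
    (forall y1 y2 z, h w t y1 z = h w t y2 z) /\ (forall y, h w t y 0 = 0).

(* A coefficient depending only on (omega, t, z), seen as an h. *)
Definition lift_y (g : Omega -> R -> 'rV[R]_d -> R)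
    : Omega -> R -> R -> 'rV[R]_d -> R :=
  fun w t _ z => g w t z.

(* Measurability of a generator in (omega, t), which is what gives a meaning
   to the integrals \int g(s, z_s) ds for Lipschitz g and predictable z. *)
Definition predictable_coef (g : Omega -> R -> 'rV[R]_d -> R) : Prop :=
  forall z, predictable (fun w t => g w t z).

Definition infconv_gen (g1 g2 : Omega -> R -> 'rV[R]_d -> R)
    : Omega -> R -> 'rV[R]_d -> R :=
  fun w t z => inf [set g1 w t (z - y) + g2 w t y | y in [set: 'rV[R]_d]].

Definition is_argmin {V : Type} (f : V -> R) (y0 : V) : Prop :=
  forall y, f y0 <= f y.

(** Supersolutions and minimal solutions *)

Definition increasing_process (C : Omega -> R -> R) : Prop :=
  adapted C /\
  {ae P, forall w, [/\ C w 0 = 0,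
     forall s t, 0 <= s -> s <= t -> t <= T -> C w s <= C w t &
     forall t, 0 <= t < T -> C w x @[x --> t^'+] --> C w t]}.

Definition supersolution (g : Omega -> R -> 'rV[R]_d -> R) (xi : Omega -> R)
    (y : Omega -> R -> R) (z : Omega -> R -> 'rV[R]_d) (C : Omega -> R -> R)
    : Prop :=
  [/\ L2T xi, adapted y, increasing_process C,
      {ae P, forall w,
         mu.-integrable `[0, T] (fun s => (g w s (z w s))%:E)} &
      exists I, is_ito z I /\
        {ae P, forall w, forall t, 0 <= t <= T ->
           y w t = xi w + (\int[mu]_(s in `[t, T]) g w s (z w s))
                   - (I w T - I w t) + (C w T - C w t)}].

Definition satisfies_constraint (phi : R -> 'rV[R]_d -> R)
    (z : Omega -> R -> 'rV[R]_d) : Prop :=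
  dtdP_ae (fun w t => phi t (z w t) = 0).

Definition gGamma_solution (g : Omega -> R -> 'rV[R]_d -> R)
    (phi : R -> 'rV[R]_d -> R) (xi : Omega -> R)
    (y : Omega -> R -> R) (z : Omega -> R -> 'rV[R]_d) (C : Omega -> R -> R)
    : Prop :=
  [/\ supersolution g xi y z C, satisfies_constraint phi z &
      forall y' z' C', supersolution g xi y' z' C' ->
        satisfies_constraint phi z' ->
        dtdP_ae (fun w t => y w t <= y' w t)].

(* [y] is (a version of) the process E^{g,phi}(xi).  Minimality makes it unique
   up to indistinguishability. *)
Definition gGamma_expectation (g : Omega -> R -> 'rV[R]_d -> R)
    (phi : R -> 'rV[R]_d -> R) (xi : Omega -> R) (y : Omega -> R -> R) : Prop :=
  exists z C, gGamma_solution g phi xi y z C.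

(* rho(X) = E_0^{g,phi}(-X) = r; E_0 is a.s. constant, since W_0 = 0 a.s.
   makes the time-0 sigma-algebra trivial.  With this sign, the position whose
   risk is governed by the terminal value eta is X = - eta. *)
Definition risk_measure (g : Omega -> R -> 'rV[R]_d -> R)
    (phi : R -> 'rV[R]_d -> R) (X : Omega -> R) (r : R) : Prop :=
  exists2 y, gGamma_expectation g phi (\- X) y & {ae P, forall w, y w 0 = r}.

(* xi attains the infimum over xi' in L^infty of rho1(X - xi') + rho2(xi'). *)
Definition optimal_transfer (rho1 rho2 : (Omega -> R) -> R -> Prop)
    (X xi : Omega -> R) : Prop :=
  Linf xi /\
  exists r1 r2, [/\ rho1 (X \- xi) r1, rho2 xi r2 &
    forall xi' s1 s2, Linf xi' -> rho1 (X \- xi') s1 -> rho2 xi' s2 ->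
      r1 + r2 <= s1 + s2].

Definition is_essinf (F : set (Omega -> R)) (X : Omega -> R) : Prop :=
  [/\ measurable_fun setT X,
      forall Y, F Y -> {ae P, forall w, X w <= Y w} &
      forall X' : Omega -> R, measurable_fun setT X' ->
        (forall Y, F Y -> {ae P, forall w, X' w <= Y w}) ->
        {ae P, forall w, X' w <= X w}].

(* X is the inf-convolution at time t of E^{g1,phi} and E^{g2,phi} at eta. *)
Definition is_infconv (g1 g2 : Omega -> R -> 'rV[R]_d -> R)
    (phi : R -> 'rV[R]_d -> R) (t : R) (eta X : Omega -> R) : Prop :=
  is_essinf
    [set Y | exists xi y1 y2, [/\ Linf xi,
       gGamma_expectation g1 phi (eta \- xi) y1,
       gGamma_expectation g2 phi xi y2 & Y = fun w => y1 w t + y2 w t]] X.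

End Brownian.
End StochasticCalculus.

(* Main.v *)
(* Let g3 be the inf-convolution of g1 and g2.  Adding a g1-supersolution
   (y1, z1, C1) and a g2-supersolution (y2, z2, C2) gives a g3-supersolution
   whose increasing process also absorbs the loss
   g1(z1) + g2(z2) - g3(z1 + z2) >= 0, and subadditivity of phi preserves the
   constraint.  So (1) is the minimality of y3, made pointwise in time by
   right-continuity.

   For (2), y2 := Ihat - int_0^. g2(zhat) is a g2-supersolution with terminal
   value - xistar and no increasing process, and since zhat is optimal,
   y1 := y3 - y2 is a g1-supersolution of eta + xistar.  Both are minimal
   without appeal to a comparison theorem for BSDEs: a competitor y' of y2
   yields the competitor y1 + y' of y3 = y1 + y2, hence y2 <= y', and
   symmetrically for y1.  Thus y1 + y2 = y3 attains the lower bound (1). *)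

Require Import Defs.
From HB Require Import structures.
From mathcomp Require Import all_boot all_order all_algebra.
From mathcomp Require Import all_classical all_reals all_analysis.
From mathcomp Require Import measurable_realfun ring lra.
Import Order.TTheory GRing.Theory Num.Theory.
Import numFieldNormedType.Exports.

Set Implicit Arguments.
Unset Strict Implicit.
Unset Printing Implicit Defensive.

Local Open Scope classical_set_scope.
Local Open Scope ring_scope.

(** * Euclidean and l1 norms of row vectors *)

Section Norms.
Context {R : realType} {n : nat}.
Implicit Types u v z : 'rV[R]_n.

(** The l1 norm. Lipschitz bounds are stated with it because measurability and rational
    approximation then reduce to single coordinates. *)
Definition norm1 u : R := \sum_i `|u 0 i|.

Lemma dotv_ge0 u : 0 <= dotv u u.
Proof. by apply: sumr_ge0 => i _; rewrite -expr2 sqr_ge0. Qed.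

Lemma enorm_ge0 u : 0 <= enorm u.
Proof. exact: sqrtr_ge0. Qed.

Lemma enorm_sqr u : enorm u ^+ 2 = \sum_i (u 0 i) ^+ 2.
Proof.
by rewrite sqr_sqrtr ?dotv_ge0//; apply: eq_bigr => i _; rewrite expr2.
Qed.

Lemma norm1_ge0 u : 0 <= norm1 u.
Proof. exact: sumr_ge0. Qed.

Lemma sum_sqr_le_sqr_sum (I : Type) (r : seq I) (f : I -> R) :
  \sum_(i <- r) (f i) ^+ 2 <= (\sum_(i <- r) `|f i|) ^+ 2.
Proof.
elim: r => [|i r IH]; first by rewrite !big_nil expr0n.
rewrite !big_cons sqrrD real_normK ?num_real// -addrA lerD2l.
by rewrite (le_trans IH)// lerDr mulrn_wge0// mulr_ge0// sumr_ge0.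
Qed.

Lemma enorm_le_norm1 u : enorm u <= norm1 u.
Proof.
rewrite -ler_sqr ?nnegrE ?enorm_ge0 ?norm1_ge0// enorm_sqr.
exact: sum_sqr_le_sqr_sum.
Qed.

Lemma normr_le_1Dsqr (x : R) : `|x| <= 1 + x ^+ 2.
Proof. by rewrite ler_norml; nra. Qed.

(** Trades linear growth for quadratic growth, so that square-integrability of an integrand controls
    generators of linear growth. *)
Lemma norm1_le_enorm_sqr u : norm1 u <= n%:R + enorm u ^+ 2.
Proof.
rewrite enorm_sqr (_ : n%:R = \sum_(i < n) (1 : R)); last first.
  by rewrite sumr_const card_ord.
by rewrite -big_split/=; apply: ler_sum => i _; exact: normr_le_1Dsqr.
Qed.

Lemma enormN u : enorm (- u) = enorm u.
Proof.
rewrite /enorm; congr Num.sqrt; apply: eq_bigr => i _.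
by rewrite mxE mulrNN.
Qed.

(** Coordinatewise the gap is a perfect square. This crude bound stands in for Minkowski's
    inequality: it suffices for finiteness and for convergence to zero. *)
Lemma enormD_sqr u v :
  enorm (u + v) ^+ 2 <= 2 * enorm u ^+ 2 + 2 * enorm v ^+ 2.
Proof.
rewrite !enorm_sqr !mulr_sumr -big_split/=.
apply: ler_sum => i _; rewrite mxE -subr_ge0.
rewrite (_ : _ - _ = (u 0 i - v 0 i) ^+ 2) ?sqr_ge0//; ring.
Qed.

Lemma norm1_dense_rat z (e : R) : 0 < e ->
  exists q : 'rV[rat]_n, norm1 (z - map_mx ratr q) < e.
Proof.
(* Dividing by n + 1 keeps the sum of n errors strictly below e, also when n = 0. *)
move=> e0; pose de := e / n.+1%:R; have d0 : 0 < de by rewrite divr_gt0.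
have H i : exists q : rat, `|z 0 i - ratr q| < de.
  have /rat_in_itvoo[q] : z 0 i - de < z 0 i + de by lra.
  by rewrite in_itv/= => /andP[? ?]; exists q; rewrite ltr_norml; lra.
have [q qP] := choice H.
exists (\row_i q i); apply: (@le_lt_trans _ _ (\sum_(i < n) de)).
  by apply: ler_sum => i _; rewrite !mxE ltW.
rewrite sumr_const card_ord -mulr_natr -mulrA gtr_pMr//.
by rewrite mulrC ltr_pdivrMr// mul1r ltr_nat.
Qed.

End Norms.

(** * Superposition and infimal convolution of Lipschitz functions *)

Section MeasurableInf.
Context d (T : measurableType d) (R : realType).
Implicit Type D : set T.

(** The hypothesis says that f is the pointwise infimum of the [F i]; each strict sublevel set of f
    is then a countable union of measurable sets, and these rays generate the Borel sets. *)
Lemma measurable_fun_countable_inf (I : countType) D (f : T -> R)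
    (F : I -> T -> R) :
  (forall i, measurable_fun D (F i)) ->
  (forall x c, D x -> f x < c <-> exists i, F i x < c) ->
  measurable_fun D f.
Proof.
move=> mF fF mD; apply: (measurability _ (RGenInftyO.measurableE R)) => //.
move=> _ [_ [c ->] <-].
(* Naturals that encode no index contribute the empty set. *)
rewrite [X in measurable X](_ : _ = \bigcup_n
    oapp (fun i => D `&` F i @^-1` `]-oo, c[) set0 (unpickle n)).
  apply: bigcupT_measurable => k; case: (unpickle k) => //= i.
  by apply: mF => //; exact: measurable_itv.
apply/seteqP; split=> [x [Dx] /=|x [k _] /=].
  rewrite in_itv/= => /(fF _ _ Dx)[i Fi].
  by exists (pickle i) => //; rewrite pickleK /= in_itv.
case: (unpickle k) => //= i [Dx]; rewrite in_itv/= => Fi; split => //.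
by rewrite in_itv/=; apply/(fF _ _ Dx); exists i.
Qed.

Context {n : nat}.

Definition lipschitz_on D (M : R) (f : T -> 'rV[R]_n -> R) :=
  forall x u v, D x -> `|f x u - f x v| <= M * norm1 (u - v).

Lemma lipschitz_near D M (f : T -> 'rV[R]_n -> R) x z (e : R) :
  0 <= M -> lipschitz_on D M f -> D x -> 0 < e ->
  exists q : 'rV[rat]_n, M * norm1 (z - map_mx ratr q) < e.
Proof.
move=> M0 Lf Dx e0.
(* Dividing by M + 1 covers M = 0 as well. *)
have [q qz] := norm1_dense_rat z (e := e / (M + 1)) ltac:(by rewrite divr_gt0//; lra).
exists q; apply: (@le_lt_trans _ _ (M * (e / (M + 1)))).
  by rewrite ler_wpM2l// ltW.
by rewrite mulrCA gtr_pMr// ltr_pdivrMr; lra.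
Qed.

(* Lipschitz continuity turns f x (Z x) into the infimum of
   f x q + M |Z x - q| over rational q. *)
Lemma measurable_fun_lipschitz_comp D (M : R) (f : T -> 'rV[R]_n -> R)
    (Z : T -> 'rV[R]_n) :
  0 <= M -> lipschitz_on D M f -> (forall z, measurable_fun D (f^~ z)) ->
  (forall i, measurable_fun D (fun x => Z x 0 i)) ->
  measurable_fun D (fun x => f x (Z x)).
Proof.
move=> M0 Lf mf mZ.
apply: (@measurable_fun_countable_inf 'rV[rat]_n _ _
  (fun q x => f x (map_mx ratr q) + M * norm1 (Z x - map_mx ratr q))).
  move=> q; apply: measurable_funD => //.
  apply: measurable_funM => //.
  apply: measurable_sum => i; apply: measurableT_comp => //.
  rewrite (_ : (fun _ => _) = (fun x => Z x 0 i - ratr (q 0 i))); last first.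
    by apply/funext => x; rewrite !mxE.
  exact: measurable_funB.
move=> x c Dx; split => [fc|[q]]; last first.
  by apply: le_lt_trans; have := Lf x (Z x) (map_mx ratr q) Dx;
    rewrite ler_norml => /andP[]; lra.
(* Half the gap, because the error M |Z x - q| enters twice: through f and through the added
   penalty. *)
have [q qz] := lipschitz_near (Z x) (e := (c - f x (Z x)) / 2) M0 Lf Dx ltac:(lra).
exists q; have := Lf x (Z x) (map_mx ratr q) Dx.
by rewrite ler_norml => /andP[]; lra.
Qed.

(** The slopes of the two affine minorants agree, so their sum at z - y and y does not depend on y
    and bounds the whole set from below. *)
Lemma has_inf_infconv (h1 h2 : 'rV[R]_n -> R) (a : 'rV[R]_n) (b : R) z :
  (forall y, dotv a y + b <= h1 y) -> (forall y, dotv a y + b <= h2 y) ->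
  has_inf [set h1 (z - y) + h2 y | y in [set: 'rV[R]_n]] /\
  lbound [set h1 (z - y) + h2 y | y in [set: 'rV[R]_n]] (dotv a z + 2 * b).
Proof.
move=> h1ab h2ab; set S := (X in has_inf X).
have Slb : lbound S (dotv a z + 2 * b).
  move=> _ [y _ <-].
  have -> : dotv a z = dotv a (z - y) + dotv a y.
    rewrite /dotv -big_split/=; apply: eq_bigr => i _.
    by rewrite !mxE -mulrDr subrK.
  by have := h1ab (z - y); have := h2ab y; lra.
split => //; split; first by exists (h1 (z - 0) + h2 0); exists 0.
by exists (dotv a z + 2 * b).
Qed.

(** The expression under the infimum is Lipschitz in y with constant [M1 + M2], so a near-minimiser
    can be moved to a rational point; countably many measurable functions then give the infimum. *)
Lemma measurable_fun_infconv D (M1 M2 : R) (f1 f2 : T -> 'rV[R]_n -> R)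
    (Z : T -> 'rV[R]_n) (a : 'rV[R]_n) (b : R) :
  0 <= M1 -> lipschitz_on D M1 f1 -> (forall z, measurable_fun D (f1^~ z)) ->
  0 <= M2 -> lipschitz_on D M2 f2 -> (forall z, measurable_fun D (f2^~ z)) ->
  (forall x z, D x -> dotv a z + b <= f1 x z) ->
  (forall x z, D x -> dotv a z + b <= f2 x z) ->
  (forall i, measurable_fun D (fun x => Z x 0 i)) ->
  measurable_fun D
    (fun x => inf [set f1 x (Z x - y) + f2 x y | y in [set: 'rV[R]_n]]).
Proof.
move=> M10 L1 mf1 M20 L2 mf2 f1ab f2ab mZ.
apply: (@measurable_fun_countable_inf 'rV[rat]_n _ _
  (fun q x => f1 x (Z x - map_mx ratr q) + f2 x (map_mx ratr q))).
  move=> q; apply: measurable_funD => //.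
  apply: (measurable_fun_lipschitz_comp M10) => //= i.
  rewrite (_ : (fun _ => _) = (fun x => Z x 0 i - ratr (q 0 i))); last first.
    by apply/funext => x; rewrite !mxE.
  exact: measurable_funB.
move=> x c Dx.
have [infS _] := has_inf_infconv (Z x) (fun y => f1ab x y Dx) (fun y => f2ab x y Dx).
split => [fc|[q]]; last first.
  by apply: le_lt_trans; apply: ge_inf; [exact: infS.2|exists (map_mx ratr q)].
have [_ [y _ <-] yc] := inf_lt infS.1 fc.
have M0 : 0 <= M1 + M2 by exact: addr_ge0.
have L : lipschitz_on D (M1 + M2) (fun x y => f1 x (Z x - y) + f2 x y).
  move=> t u v Dt.
  have := L1 t (Z t - u) (Z t - v) Dt; have := L2 t u v Dt.
  have -> : norm1 (Z t - u - (Z t - v)) = norm1 (u - v).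
    by apply: eq_bigr => i _; rewrite !mxE -[LHS]normrN; congr `|_|; lra.
  rewrite mulrDl (_ : (_ + _ - _) =
    (f1 t (Z t - u) - f1 t (Z t - v)) + (f2 t u - f2 t v)); last by lra.
  by move=> ? ?; rewrite (le_trans (ler_normD _ _))// lerD.
have [q qz] := lipschitz_near y M0 L Dx
  (e := c - (f1 x (Z x - y) + f2 x y)) ltac:(lra).
exists q; have := L x y (map_mx ratr q) Dx.
by rewrite ler_norml => /andP[]; lra.
Qed.

End MeasurableInf.

(** * Sections of product-measurable functions and integrals depending on a parameter *)

Section Sections.
Context d (T1 : measurableType d) (R : realType).
Local Notation mu := (@lebesgue_measure R).
Implicit Types (D : set R) (f : T1 * R -> R).

Lemma measurable_fun_section D f (x : T1) : measurable D ->
  measurable_fun (setT `*` D) f -> measurable_fun D (fun s => f (x, s)).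
Proof.
move=> mD mf; apply: (measurable_comp _ _ mf); first exact: measurableX.
  by move=> _ [s Ds <-].
exact/measurable_funTS/pair1_measurable.
Qed.

(** Tonelli's theorem applied to the extension of f by zero outside the strip. *)
Lemma measurable_fun_ge0_integral_section D f : measurable D ->
  measurable_fun (setT `*` D) f -> (forall x s, D s -> 0 <= f (x, s)) ->
  measurable_fun setT (fun x => \int[mu]_(s in D) (f (x, s))%:E)%E.
Proof.
move=> mD mf f0; pose g := (EFin \o f) \_ (setT `*` D).
have mg : measurable_fun setT g.
  apply/(measurable_restrictT _ _).1; first exact: measurableX.
  exact: measurableT_comp.
have g0 y : (0 <= g y)%E.
  by rewrite /g patchE; case: ifPn => // /set_mem[_ Dy] /=; rewrite lee_fin;
    case: y Dy => x s; exact: f0.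
apply: (eq_measurable_fun (fun x => \int[mu]_s g (x, s))%E).
  move=> x _; rewrite [RHS]integral_mkcond; apply: eq_integral => s _.
  by rewrite /g !patchE; congr (if _ then _ else _); apply/idP/idP => /set_mem H;
    apply/mem_set => //; case: H.
exact: measurable_fun_fubini_tonelli_F.
Qed.

(** Positive and negative parts are integrated separately in the extended reals, so no integrability
    is assumed. The space [T1] is arbitrary, which allows a sub-sigma-algebra such as that of the
    filtration at time t. *)
Lemma measurable_fun_Rintegral_section D f : measurable D ->
  measurable_fun (setT `*` D) f ->
  measurable_fun setT (fun x => \int[mu]_(s in D) f (x, s)).
Proof.
move=> mD mf.
have mpos : measurable_fun (setT `*` D) (f^\+).
  by apply: measurable_funrpos.
have mneg : measurable_fun (setT `*` D) (f^\-).
  by apply: measurable_funrneg.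
apply: (measurableT_comp (@fine_measurable R setT measurableT)).
apply: (eq_measurable_fun (fun x => \int[mu]_(s in D) (f^\+ (x, s))%:E -
                                    \int[mu]_(s in D) (f^\- (x, s))%:E)%E).
  move=> x _; rewrite [RHS]integralE; congr (_ - _)%E; apply: eq_integral => s _.
    by rewrite funeposE /funrpos/= EFin_max.
  by rewrite funenegE /funrneg/= EFin_max.
by apply: emeasurable_funB; apply: measurable_fun_ge0_integral_section => // *;
  rewrite ?funrpos_ge0 ?funrneg_ge0.
Qed.

(** The measures of the sections of a product-null set integrate to zero, so almost every section is
    null. *)
Lemma ae_product_section (P : {measure set T1 -> \bar R}) (Q : T1 * R -> Prop) :
  {ae (P \x mu)%E, forall x, Q x} ->
  {ae P, forall x, {ae mu, forall s, Q (x, s)}}.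
Proof.
move=> [N [mN N0 QN]].
have : ae_eq P setT (mu \o xsection N)%E (cst 0%E).
  apply/ae_eq_integral_abs => //.
    exact: measurable_fun_xsection.
  rewrite -[RHS]N0; apply: eq_integral => x _ /=.
  by rewrite gee0_abs.
apply: filterS => x /= /(_ Logic.I) Nx.
exists (xsection N x); split => //; first exact: measurable_xsection.
move=> s nQ; apply/xsectionP; exact: QN.
Qed.

End Sections.

(** * Progressive measurability and square-integrable integrands *)

Section Processes.
Context {disp : measure_display} {Omega : measurableType disp} {R : realType}.
Variables (P : probability Omega R) (T : R) (T_ge0 : 0 <= T).
Variables (d : nat) (W : Omega -> R -> 'rV[R]_d).
Hypothesis W_meas : forall t i, 0 <= t <= T ->
  measurable_fun setT (fun w => W w t 0 i).
Local Notation mu := (@lebesgue_measure R).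

(** The augmentation adds measurable null sets only, so it stays inside the ambient
    sigma-algebra. *)
Lemma filtration_measurable t A : 0 <= t <= T ->
  filtration P W t A -> measurable A.
Proof.
move=> /andP[t0 tT]; apply: smallest_sub; first exact: sigma_algebra_measurable.
move=> B [[s [i [C [/andP[s0 st] mC ->]]]]|[]//].
rewrite -[X in measurable X]setTI; apply: W_meas => //.
by rewrite s0 (le_trans st).
Qed.

Lemma le_filtration s t : s <= t -> filtration P W s `<=` filtration P W t.
Proof.
move=> st; apply: sub_sigma_algebra2 => B [[u [i [C [/andP[u0 us] mC ->]]]]|];
  last by right.
by left; exists u, i, C; split => //; rewrite u0 (le_trans us).
Qed.

Lemma rv_measurableT t X : 0 <= t <= T -> rv_measurable P W t X ->
  measurable_fun setT X.
Proof.
by move=> tT mX _ Y mY; apply: (filtration_measurable tT); exact: mX.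
Qed.

(** The strip is the slice at time 0 together with the left-open rectangle over ]0, T]; both are
    generators, the second being empty when T = 0. *)
Lemma predictable_gen_time_interval :
  @measurable _ (g_sigma_algebraType (predictable_gen P T W)) (setT `*` `[0, T]).
Proof.
rewrite (_ : _ `*` _ = (setT `*` [set 0]) `|` (setT `*` [set` `]0, T]])); last first.
  apply/seteqP; split => [[w t] [_]|[w t] [] [_]] /=.
  - rewrite in_itv/= => /andP[]; rewrite le_eqVlt => /predU1P[<-|t0] tT.
      by left.
    by right; split => //; rewrite in_itv/= t0.
  - by move=> ->; split => //; rewrite in_itv/= lexx.
  - by rewrite in_itv/= => /andP[t0 tT]; split => //; rewrite in_itv/= ltW.
have F0 : filtration P W 0 setT.
  exact: (@measurableT _ (g_sigma_algebraType (filtration_gen P W 0))).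
apply: (@measurableU _ (g_sigma_algebraType (predictable_gen P T W)));
  apply: sub_sigma_algebra.
  by left; exists setT.
move: T_ge0; rewrite le_eqVlt => /predU1P[T0|T0].
  left; exists set0; split; first exact: sigma_algebra0.
  by rewrite -T0 set_itvoc0 !setX0 set0X.
by right; exists 0, T, setT.
Qed.

(** The sets whose trace on [0, t] is measurable for the product of the sigma-algebra at t with the
    Borel sets form a sigma-algebra, so it is enough to look at generators. *)
Lemma predictable_progressive t X : 0 <= t <= T -> predictable P T W X ->
  @measurable_fun _ _ (g_sigma_algebraType (filtration_gen P W t) * R)%type R
    (setT `*` `[0, t]) (fun x => X x.1 x.2).
Proof.
move=> /andP[t0 tT] mX _ Y mY.
set V := (g_sigma_algebraType (filtration_gen P W t) * R)%type.
set E := _ `*` _; have mE : @measurable _ V E by exact: measurableX.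
suff S : <<s predictable_gen P T W >> `<=`
    [set A : set V | measurable (E `&` A)].
  have := mX predictable_gen_time_interval _ mY; move=> /S.
  rewrite /= setIA (_ : E `&` _ = E)//; apply/setIidl => -[w s] [_].
  by rewrite /= !in_itv/= => /andP[-> st]; split => //; exact: le_trans tT.
apply: smallest_sub.
  split => /=.
  - by rewrite setI0.
  - move=> A mA; rewrite setTD (_ : E `&` ~` A = E `\` (E `&` A)).
      exact: measurableD.
    by rewrite setDIr setDv set0U setDE.
  - by move=> F mF; rewrite setI_bigcupr; exact: bigcupT_measurable.
move=> D [[A [FA ->]]|[s [u [A [s0 su uT FA ->]]]]] /=.
  rewrite /E -setXI setTI; apply: measurableX; last exact: measurableI.
  by apply: (le_filtration t0).
(* If s < t, then A belongs to the sigma-algebra at s, hence to that at t; otherwise the rectangle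
   over ]s, u] misses [0, t]. *)
have [st|ts] := ltP s t.
  rewrite /E -setXI setTI; apply: measurableX; last exact: measurableI.
  by apply: (le_filtration (ltW st)).
rewrite (_ : _ `&` _ = set0)//; apply/seteqP; split => // -[w v] /= [[_]].
rewrite !in_itv/= => /andP[_ vt] [_ /andP[sv _]].
by move: (lt_le_trans sv vt); rewrite ltNge ts.
Qed.

(** Progressive measurability lets the parameter integral be taken over Omega with the sigma-algebra
    at t. *)
Lemma adapted_Rintegral X : predictable P T W X ->
  adapted P T W (fun w t => \int[mu]_(s in `[0, t]) X w s).
Proof.
move=> mX t tT.
have := predictable_progressive tT mX.
exact: (@measurable_fun_Rintegral_section _
  (g_sigma_algebraType (filtration_gen P W t)) R `[0, t] (fun x => X x.1 x.2)).
Qed.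

(** Progressive measurability at T, composed with the identity from the full product to the coarser
    one carrying the sigma-algebra at T. *)
Lemma predictable_jointly X : predictable P T W X ->
  measurable_fun (setT `*` `[0, T]) (fun x : Omega * R => X x.1 x.2).
Proof.
have TT : 0 <= T <= T by rewrite T_ge0 lexx.
move=> /(predictable_progressive TT) mX.
set V := (g_sigma_algebraType (filtration_gen P W T) * R)%type in mX.
have mid : @measurable_fun _ _ (Omega * R)%type V setT id.
  apply/measurable_fun_pairP; split; last exact: measurable_snd.
  move=> _ Y mY; apply: (measurable_fst measurableT).
  exact: (filtration_measurable TT).
apply: (@measurable_comp _ _ _ (Omega * R)%type V R (setT `*` `[0, T])
  (fun x => X x.1 x.2) (setT `*` `[0, T]) id _ _ mX (measurable_funTS mid)).
  exact: (@measurableX _ _ (g_sigma_algebraType (filtration_gen P W T)) R).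
by move=> _ [x Dx <-].
Qed.

Lemma predictableD X Y : predictable P T W X -> predictable P T W Y ->
  predictable P T W (fun w t => X w t + Y w t).
Proof. exact: measurable_funD. Qed.

Lemma predictableN X : predictable P T W X ->
  predictable P T W (fun w t => - X w t).
Proof. by move=> mX; apply: measurableT_comp. Qed.

Lemma adaptedD X Y : adapted P T W X -> adapted P T W Y ->
  adapted P T W (fun w t => X w t + Y w t).
Proof. by move=> mX mY t tT; apply: measurable_funD; [exact: mX|exact: mY]. Qed.

Lemma adaptedN X : adapted P T W X -> adapted P T W (fun w t => - X w t).
Proof. by move=> mX t tT; apply: measurableT_comp => //; exact: mX. Qed.

Lemma jointly_measurableD (z z' : Omega -> R -> 'rV[R]_d) :
  jointly_measurable T z -> jointly_measurable T z' ->
  jointly_measurable T (fun w t => z w t + z' w t).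
Proof.
move=> mz mz' i; rewrite (_ : (fun _ => _) =
  (fun x => z x.1 x.2 0 i + z' x.1 x.2 0 i)); last first.
  by apply/funext => x; rewrite mxE.
exact: measurable_funD.
Qed.

Lemma jointly_measurableN (z : Omega -> R -> 'rV[R]_d) :
  jointly_measurable T z -> jointly_measurable T (fun w t => - z w t).
Proof.
move=> mz i; rewrite (_ : (fun _ => _) = (fun x => - z x.1 x.2 0 i)); last first.
  by apply/funext => x; rewrite mxE.
exact: measurableT_comp.
Qed.

Lemma measurable_enorm_sqr (z : Omega -> R -> 'rV[R]_d) :
  jointly_measurable T z ->
  measurable_fun (setT `*` `[0, T])
    (fun x : Omega * R => enorm (z x.1 x.2) ^+ 2).
Proof.
move=> mz; rewrite (_ : (fun _ => _) =
  (fun x => \sum_i (z x.1 x.2 0 i) ^+ 2)); last first.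
  by apply/funext => x; rewrite enorm_sqr.
by apply: measurable_sum => i; exact: measurable_funX.
Qed.

Lemma ge0_integral_lc (dU : measure_display) (U : measurableType dU)
    (m : {measure set U -> \bar R}) (D : set U) (f g : U -> \bar R) (c : R) :
  measurable D -> (0 <= c) ->
  measurable_fun D f -> (forall x, D x -> 0 <= f x)%E ->
  measurable_fun D g -> (forall x, D x -> 0 <= g x)%E ->
  (\int[m]_(x in D) (c%:E * f x + c%:E * g x) =
   c%:E * \int[m]_(x in D) f x + c%:E * \int[m]_(x in D) g x)%E.
Proof.
move=> mD c0 mf f0 mg g0; rewrite ge0_integralD//.
- by rewrite !ge0_integralZl//.
- by move=> x Dx; rewrite mule_ge0// f0.
- exact: measurable_funeM.
- by move=> x Dx; rewrite mule_ge0// g0.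
- exact: measurable_funeM.
Qed.

Lemma sq_norm_ge0 m (z : Omega -> R -> 'rV[R]_m) : (0 <= sq_norm P T z)%E.
Proof.
by apply: integral_ge0 => w _; apply: integral_ge0 => t _; rewrite lee_fin sqr_ge0.
Qed.

Lemma sq_normN (z : Omega -> R -> 'rV[R]_d) :
  sq_norm P T (fun w t => - z w t) = sq_norm P T z.
Proof.
apply: eq_integral => w _; apply: eq_integral => t _.
by rewrite enormN.
Qed.

Lemma sq_normD (z z' : Omega -> R -> 'rV[R]_d) :
  jointly_measurable T z -> jointly_measurable T z' ->
  (sq_norm P T (fun w t => z w t + z' w t)%R <=
   2%R%:E * sq_norm P T z + 2%R%:E * sq_norm P T z')%E.
Proof.
move=> mz mz'.
have mI (u : Omega -> R -> 'rV[R]_d) : jointly_measurable T u ->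
    measurable_fun setT
      (fun w => \int[mu]_(t in `[0%R, T]) (enorm (u w t) ^+ 2)%:E)%E.
  move=> /measurable_enorm_sqr mu2.
  by apply: (measurable_fun_ge0_integral_section _ mu2) => // w t _; exact: sqr_ge0.
have mS (u : Omega -> R -> 'rV[R]_d) w : jointly_measurable T u ->
    measurable_fun `[0, T] (fun t => (enorm (u w t) ^+ 2)%:E).
  move=> /measurable_enorm_sqr mu2; apply: measurableT_comp => //.
  exact: (measurable_fun_section w _ mu2).
rewrite -ge0_integral_lc//; [|exact: mI| |exact: mI|]; last 2 first.
- by move=> w _; apply: integral_ge0 => t _; rewrite lee_fin sqr_ge0.
- by move=> w _; apply: integral_ge0 => t _; rewrite lee_fin sqr_ge0.
apply: ge0_le_integral => //.
- by move=> w _; apply: integral_ge0 => t _; rewrite lee_fin sqr_ge0.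
- exact: mI (jointly_measurableD mz mz').
- by apply: emeasurable_funD; apply: measurable_funeM; exact: mI.
move=> w _; rewrite -ge0_integral_lc//; first last.
- by move=> t _; rewrite lee_fin sqr_ge0.
- exact: mS.
- by move=> t _; rewrite lee_fin sqr_ge0.
- exact: mS.
apply: ge0_le_integral => //.
- by move=> t _; rewrite lee_fin sqr_ge0.
- exact: mS (jointly_measurableD mz mz').
- by apply: emeasurable_funD; apply: measurable_funeM; exact: mS.
by move=> t _; rewrite -!EFinM -EFinD lee_fin enormD_sqr.
Qed.

Lemma H2_jointly (z : Omega -> R -> 'rV[R]_d) : H2 P T W z -> jointly_measurable T z.
Proof.
move=> [mz _] i; apply: (predictable_jointly (X := fun w t => z w t 0 i)).
exact: mz.
Qed.

Lemma H2N (z : Omega -> R -> 'rV[R]_d) : H2 P T W z ->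
  H2 P T W (fun w t => - z w t).
Proof.
move=> [mz z2]; split; last by rewrite sq_normN.
move=> i; rewrite (_ : (fun _ => _) = (fun w t => - z w t 0 i)).
  exact: predictableN.
by apply/funext => w; apply/funext => t; rewrite mxE.
Qed.

Lemma H2D (z z' : Omega -> R -> 'rV[R]_d) : H2 P T W z -> H2 P T W z' ->
  H2 P T W (fun w t => z w t + z' w t).
Proof.
move=> Hz Hz'; split; last first.
  apply: (le_lt_trans (sq_normD (H2_jointly Hz) (H2_jointly Hz'))).
  by apply: lte_add_pinfty; rewrite lte_mul_pinfty// ?Hz.2 ?Hz'.2.
move=> i; rewrite (_ : (fun _ => _) = (fun w t => z w t 0 i + z' w t 0 i)).
  by apply: predictableD; [exact: Hz.1|exact: Hz'.1].
by apply/funext => w; apply/funext => t; rewrite mxE.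
Qed.

(** A nonnegative variable with finite expectation is almost surely finite; here it is the time
    integral of |z|^2. *)
Lemma H2_path_integrable (z : Omega -> R -> 'rV[R]_d) : H2 P T W z ->
  {ae P, forall w, mu.-integrable `[0, T] (fun t => (enorm (z w t) ^+ 2)%:E)}.
Proof.
move=> Hz; have mz2 := measurable_enorm_sqr (H2_jointly Hz).
have intP : P.-integrable setT
    (fun w => \int[mu]_(t in `[0%R, T]) (enorm (z w t) ^+ 2)%:E)%E.
  apply/integrableP; split.
    by apply: (measurable_fun_ge0_integral_section _ mz2) => // w t _; exact: sqr_ge0.
  have := Hz.2; congr (_ < _)%E; apply: eq_integral => w _.
  by rewrite gee0_abs// integral_ge0// => t _; rewrite lee_fin sqr_ge0.
have := integrable_ae measurableT intP; apply: filterS => w /(_ Logic.I) fin.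
apply/integrableP; split.
  by apply: measurableT_comp => //; exact: (measurable_fun_section w _ mz2).
rewrite (_ : (\int[mu]_(x in _) _)%E =
  (\int[mu]_(t in `[0%R, T]) (enorm (z w t) ^+ 2)%:E)%E); last first.
  by apply: eq_integral => t _; rewrite gee0_abs// lee_fin sqr_ge0.
by move: fin; rewrite ge0_fin_numE// integral_ge0// => t _; rewrite lee_fin sqr_ge0.
Qed.

End Processes.

(** * Linearity of the Ito integral *)

Section Ito.
Context {disp : measure_display} {Omega : measurableType disp} {R : realType}.
Variables (P : probability Omega R) (T : R) (T_ge0 : 0 <= T).
Variables (d : nat) (W : Omega -> R -> 'rV[R]_d).
Hypothesis W_meas : forall t i, 0 <= t <= T ->
  measurable_fun setT (fun w => W w t 0 i).
Local Notation mu := (@lebesgue_measure R).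

Implicit Types (e : @step disp Omega R d) (S : seq (@step disp Omega R d)).

Local Notation all_valid S := (all (fun e => `[< step_valid P T W e >]) S).

Definition step_opp e : @step disp Omega R d :=
  Step (step_l e) (step_r e) (fun w => - step_coef e w).

Lemma step_valid_opp e : step_valid P T W e -> step_valid P T W (step_opp e).
Proof.
move=> [l0 lr rT mc [M cM]]; split => //=; last first.
  by exists M => w; rewrite enormN.
move=> i; rewrite (_ : (fun _ => _) = (fun w => - step_coef e w 0 i)).
  by apply: measurableT_comp => //; exact: mc.
by apply/funext => w; rewrite mxE.
Qed.

Lemma all_valid_opp S : all_valid S -> all_valid (map step_opp S).
Proof.
rewrite all_map; apply: sub_all => e /asboolP ve.
exact/asboolP/step_valid_opp.
Qed.

Lemma simple_process_opp S :
  simple_process (map step_opp S) = (fun w u => - simple_process S w u).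
Proof.
apply/funext => w; apply/funext => u; rewrite /simple_process big_map -sumrN.
by apply: eq_bigr => e _ /=; case: ifP => //; rewrite oppr0.
Qed.

Lemma simple_integral_opp S :
  simple_integral W (map step_opp S) = (fun w u => - simple_integral W S w u).
Proof.
apply/funext => w; apply/funext => u; rewrite /simple_integral big_map -sumrN.
apply: eq_bigr => e _ /=; rewrite /dotv -sumrN; apply: eq_bigr => i _.
by rewrite !mxE mulNr.
Qed.

(** Since steps may overlap, concatenating lists adds the processes without passing to a common
    refinement. *)
Lemma simple_process_cat S S' : simple_process (S ++ S') =
  (fun w u => simple_process S w u + simple_process S' w u).
Proof.
by apply/funext => w; apply/funext => u; rewrite /simple_process big_cat.
Qed.

Lemma simple_integral_cat S S' : simple_integral W (S ++ S') =
  (fun w u => simple_integral W S w u + simple_integral W S' w u).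
Proof.
by apply/funext => w; apply/funext => u; rewrite /simple_integral big_cat.
Qed.

Lemma simple_process_jointly S : all_valid S ->
  jointly_measurable T (simple_process S).
Proof.
elim: S => [_ i|e S IH /= /andP[/asboolP[l0 lr rT mc _] /IH mS]].
  rewrite (_ : (fun _ => _) = cst 0); first exact: measurable_cst.
  by apply/funext => x; rewrite /simple_process big_nil mxE.
rewrite -cat1s simple_process_cat; apply: jointly_measurableD mS => i.
have lT : 0 <= step_l e <= T by rewrite l0 (le_trans lr).
rewrite (_ : (fun _ => _) = (fun x : Omega * R =>
  if (step_l e < x.2) && (x.2 <= step_r e) then step_coef e x.1 0 i else 0)).
  apply: measurable_funTS; apply: measurable_fun_ifT => //.
    apply: measurable_and; first exact: measurable_fun_ltr.
    exact: measurable_fun_ler.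
  apply: (measurableT_comp (rv_measurableT W_meas lT (mc i))).
  exact: measurable_fst.
apply/funext => x; rewrite /simple_process big_seq1.
by case: ifP => //; rewrite mxE.
Qed.

Lemma measurable_simple_integral S t : 0 <= t <= T -> all_valid S ->
  measurable_fun setT (simple_integral W S ^~ t).
Proof.
move=> /andP[t0 tT]; elim: S => [_|e S IH /= /andP[/asboolP[l0 lr rT mc _] /IH mS]].
  rewrite (_ : (_ ^~ _) = cst 0); first exact: measurable_cst.
  by apply/funext => x; rewrite /simple_integral big_nil.
rewrite -cat1s simple_integral_cat; apply: measurable_funD mS.
have lT : 0 <= step_l e <= T by rewrite l0 (le_trans lr).
have r0 := le_trans l0 lr.
rewrite (_ : (_ ^~ _) = (fun w : Omega => \sum_(i < d) step_coef e w 0 i *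
    (W w (Num.min (step_r e) t) 0 i - W w (Num.min (step_l e) t) 0 i))); last first.
  apply/funext => w; rewrite /simple_integral big_seq1.
  by apply: eq_bigr => i _; rewrite !mxE.
apply: measurable_sum => i; apply: measurable_funM.
  exact: (rv_measurableT W_meas lT (mc i)).
by apply: measurable_funB; apply: W_meas; rewrite le_min ?r0 ?l0 t0 /= ge_min tT orbT.
Qed.

Lemma integral_sqrD (X Y : Omega -> R) :
  measurable_fun setT X -> measurable_fun setT Y ->
  (\int[P]_w ((X w + Y w) ^+ 2)%:E <=
   2%R%:E * \int[P]_w ((X w) ^+ 2)%:E + 2%R%:E * \int[P]_w ((Y w) ^+ 2)%:E)%E.
Proof.
move=> mX mY.
have m2 (Z : Omega -> R) : measurable_fun setT Z ->
    measurable_fun setT (fun w => (Z w ^+ 2)%:E).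
  by move=> mZ; apply: measurableT_comp => //; exact: measurable_funX.
rewrite -ge0_integral_lc//; [|exact: m2| |exact: m2|]; last 2 first.
- by move=> w _; rewrite lee_fin sqr_ge0.
- by move=> w _; rewrite lee_fin sqr_ge0.
apply: ge0_le_integral => //.
- by move=> w _; rewrite lee_fin sqr_ge0.
- exact: m2 (measurable_funD mX mY).
- by apply: emeasurable_funD; apply: measurable_funeM; exact: m2.
move=> w _; rewrite -!EFinM -EFinD lee_fin -subr_ge0.
by rewrite (_ : _ - _ = (X w - Y w) ^+ 2) ?sqr_ge0//; ring.
Qed.

Lemma cvge0_lc (u v w : (\bar R)^nat) (c : R) :
  (forall k, 0 <= u k)%E -> (forall k, u k <= c%:E * v k + c%:E * w k)%E ->
  v k @[k --> \oo] --> 0%E -> w k @[k --> \oo] --> 0%E ->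
  u k @[k --> \oo] --> 0%E.
Proof.
move=> u0 uvw v0 w0; apply: (@squeeze_cvge _ _ _ _ (cst 0%E) _
    (fun k => c%:E * v k + c%:E * w k)%E).
- by apply: nearW => k; rewrite u0 uvw.
- exact: cvg_cst.
have : (c%:E * v k + c%:E * w k)%E @[k --> \oo] --> (c%:E * 0 + c%:E * 0)%E.
  by apply: cvgeD; [rewrite !mule0|exact: cvgeZl|exact: cvgeZl].
by rewrite !mule0 adde0.
Qed.

Lemma is_itoN z I : is_ito P T W z I ->
  is_ito P T W (fun w t => - z w t) (fun w t => - I w t).
Proof.
move=> [Hz aI cI [S [vS Sz SI]]]; split.
- exact: H2N.
- exact: adaptedN.
- by apply: filterS cI => w cI x; apply: cvgN; exact: cI.
exists (fun k => map step_opp (S k)); split => [k||t tT].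
- exact/all_valid_opp/vS.
- have E k : sq_norm P T (fun w t => simple_process (map step_opp (S k)) w t - - z w t) =
      sq_norm P T (fun w t => simple_process (S k) w t - z w t).
    rewrite -sq_normN; congr sq_norm.
    apply/funext => w; apply/funext => t.
    by rewrite simple_process_opp opprD !opprK.
  by rewrite (funext E).
- have E k : (\int[P]_w ((simple_integral W (map step_opp (S k)) w t - - I w t) ^+ 2)%:E =
      \int[P]_w ((simple_integral W (S k) w t - I w t) ^+ 2)%:E)%E.
    by apply: eq_integral => w _; rewrite simple_integral_opp -opprD sqrrN.
  by rewrite (funext E); exact: SI.
Qed.

(** Concatenated approximations work: both squared errors, of the integrands and of the integrals,
    are at most twice the sum of the separate ones. *)
Lemma is_itoD z z' I I' : is_ito P T W z I -> is_ito P T W z' I' ->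
  is_ito P T W (fun w t => z w t + z' w t) (fun w t => I w t + I' w t).
Proof.
move=> [Hz aI cI [S [vS Sz SI]]] [Hz' aI' cI' [S' [vS' Sz' SI']]].
have jm k (S0 : nat -> seq (@step disp Omega R d)) z0 : all_valid (S0 k) ->
    H2 P T W z0 ->
    jointly_measurable T (fun w t => simple_process (S0 k) w t - z0 w t).
  move=> v0 H0; apply: jointly_measurableD; first exact: simple_process_jointly.
  exact: (jointly_measurableN (H2_jointly T_ge0 W_meas H0)).
split.
- exact: H2D.
- exact: adaptedD.
- by apply: filterS2 cI cI' => w cI cI' x; apply: cvgD; [exact: cI|exact: cI'].
exists (fun k => S k ++ S' k); split => [k||t tT].
- by rewrite all_cat vS vS'.
- apply: (@cvge0_lc _ _ _ 2 _ _ Sz Sz') => k; first exact: sq_norm_ge0.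
  rewrite (_ : (fun w => _) = (fun w t => (simple_process (S k) w t - z w t) +
      (simple_process (S' k) w t - z' w t))).
    by apply: sq_normD => //; apply: jm.
  apply/funext => w; apply/funext => t.
  by rewrite simple_process_cat opprD addrACA.
- apply: (@cvge0_lc _ _ _ 2 _ _ (SI _ tT) (SI' _ tT)) => k.
    by apply: integral_ge0 => w _; rewrite lee_fin sqr_ge0.
  under eq_integral do rewrite simple_integral_cat opprD addrACA.
  apply: integral_sqrD; apply: measurable_funB; try exact: measurable_simple_integral.
    exact: (rv_measurableT W_meas tT (aI _ tT)).
  exact: (rv_measurableT W_meas tT (aI' _ tT)).
Qed.

End Ito.

(** * Generators along paths *)

Section Paths.
Context {R : realType}.
Local Notation mu := (@lebesgue_measure R).
Implicit Types (f k : R -> R) (s t T : R).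

Lemma continuous_within_right f T t : {within `[0, T], continuous f} ->
  0 <= t < T -> f x @[x --> t^'+] --> f t.
Proof.
move=> cf /andP[t0 tT]; have T0 : 0 < T by exact: le_lt_trans tT.
have [cf1 cf0 _] := (continuous_within_itvP f T0).1 cf.
move: t0; rewrite le_eqVlt => /predU1P[<-//|t0].
by apply: cvg_at_right_filter; apply: cf1; rewrite in_itv/= t0.
Qed.

Lemma Rintegral_split f T t : mu.-integrable `[0, T] (EFin \o f) ->
  0 <= t <= T -> \int[mu]_(s in `[0, T]) f s =
  \int[mu]_(s in `[0, t]) f s + \int[mu]_(s in `[t, T]) f s.
Proof.
move=> intf /andP[t0 tT].
have intt : mu.-integrable `]t, T] (EFin \o f).
  by apply: integrableS intf => //; apply: subset_itvr; rewrite bnd_simp.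
rewrite -(Rintegral_itv_obnd_cbnd intt).
by rewrite -(Rintegral_itvB intf) ?bnd_simp//; lra.
Qed.

Lemma Rintegral_primitive_increasing k T s t :
  mu.-integrable `[0, T] (EFin \o k) ->
  (forall s, 0 <= s <= T -> 0 <= k s) -> 0 <= s -> s <= t -> t <= T ->
  \int[mu]_(u in `[0, s]) k u <= \int[mu]_(u in `[0, t]) k u.
Proof.
move=> intk k0 s0 st tT.
have intt : mu.-integrable `[0, t] (EFin \o k).
  by apply: integrableS intk => //; apply: subset_itvl; rewrite bnd_simp.
rewrite (Rintegral_split intt (t := s)) ?s0// lerDl.
apply: Rintegral_ge0 => x /=; rewrite in_itv/= => /andP[sx xt].
by rewrite k0// (le_trans s0)//= (le_trans xt).
Qed.

Lemma Rintegral_primitive_right_continuous f T t :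
  mu.-integrable `[0, T] (EFin \o f) -> 0 <= t < T ->
  \int[mu]_(s in `[0, x]) f s @[x --> t^'+] --> \int[mu]_(s in `[0, t]) f s.
Proof.
move=> intf tT; apply: (continuous_within_right (T := T)) => //.
apply: parameterized_integral_continuous => //.
by case/andP: tT => t0 /ltW; exact: le_trans.
Qed.

Lemma near_right_itv T t : 0 <= t < T -> \forall x \near t^'+, 0 <= x <= T.
Proof.
move=> /andP[t0 tT]; near=> x; apply/andP; split.
  by apply: (le_trans t0); near: x; exact: nbhs_right_ge.
by near: x; exact: nbhs_right_le.
Unshelve. all: by end_near. Qed.

(** A negative value at t would persist on an interval to the right of t, which has positive
    measure. *)
Lemma right_continuous_ae_ge0 f T t : 0 <= t < T ->
  f x @[x --> t^'+] --> f t ->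
  {ae mu, forall s, 0 <= s <= T -> 0 <= f s} -> 0 <= f t.
Proof.
move=> tT cf [N [mN N0 fN]]; rewrite leNgt; apply/negP => ft0.
have : \forall x \near t^'+, f x < 0 by exact: (cvgr_lt _ cf).
have := near_right_itv tT.
move=> /filterS2 /[apply].
move=> /(_ (fun x => 0 <= x <= T /\ f x < 0) (fun x a b => conj a b)).
move=> [e /= e0 tN].
have sub : `]t, (t + e)[ `<=` N.
  move=> x /=; rewrite in_itv/= => /andP[tx xte].
  have [|x0T fx0] := tN x _ tx.
    by rewrite /ball/= ltr0_norm; lra.
  by apply: fN => /= /(_ x0T); rewrite leNgt fx0.
have : (mu `]t, (t + e)%R[ <= mu N)%E by apply: le_measure; rewrite ?inE.
rewrite lebesgue_measure_itv/= lte_fin ltrDl e0 -EFinD N0 lee_fin.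
by lra.
Qed.

End Paths.

(** * Lipschitz generators and their inf-convolution along square-integrable integrands *)

Section Generators.
Context {disp : measure_display} {Omega : measurableType disp} {R : realType}.
Variables (P : probability Omega R) (T : R) (T_ge0 : 0 <= T).
Variables (d : nat) (W : Omega -> R -> 'rV[R]_d).
Hypothesis W_meas : forall t i, 0 <= t <= T ->
  measurable_fun setT (fun w => W w t 0 i).
Local Notation mu := (@lebesgue_measure R).
Implicit Types (g : Omega -> R -> 'rV[R]_d -> R) (z : Omega -> R -> 'rV[R]_d).

Definition lipschitz_gen (M : R) g :=
  forall w t u v, 0 <= t <= T -> `|g w t u - g w t v| <= M * norm1 (u - v).

Lemma A1_lipschitz g : A1 T (lift_y g) -> exists2 M, 0 <= M & lipschitz_gen M g.
Proof.
move=> [M [M0 LM]]; exists M; first exact: ltW.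
move=> w t u v tT; have := LM w t tT 0 u 0 v.
rewrite /lift_y subrr normr0 add0r => /le_trans; apply.
by rewrite ler_pM2l// enorm_le_norm1.
Qed.

Lemma A3_eq0 g w t : A3 T (lift_y g) -> 0 <= t <= T -> g w t 0 = 0.
Proof. by move=> g3 tT; have [_ /(_ 0)] := g3 w t tT. Qed.

Lemma lipschitz_gen_le g M w t u : lipschitz_gen M g -> A3 T (lift_y g) ->
  0 <= t <= T -> `|g w t u| <= M * norm1 u.
Proof.
by move=> Lg g0 tT; have := Lg w t u 0 tT; rewrite (A3_eq0 _ g0)// !subr0.
Qed.

Lemma predictable_comp g z M : 0 <= M -> lipschitz_gen M g ->
  predictable_coef P T W g ->
  (forall i, predictable P T W (fun w t => z w t 0 i)) ->
  predictable P T W (fun w t => g w t (z w t)).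
Proof.
move=> M0 Lg mg mz.
apply: (@measurable_fun_lipschitz_comp _
  (g_sigma_algebraType (predictable_gen P T W)) R d _ M
  (fun x => g x.1 x.2) (fun x => z x.1 x.2)) => //.
by move=> x u v [_ /=]; rewrite in_itv/= => xT; exact: Lg.
Qed.

(** Linear growth in z is dominated by a constant plus M |z|^2, which is almost surely integrable in
    time. *)
Lemma path_integrable (h : Omega -> R -> R) z (c M : R) :
  predictable P T W h -> H2 P T W z -> 0 <= M ->
  (forall w t, 0 <= t <= T -> `|h w t| <= c + M * norm1 (z w t)) ->
  {ae P, forall w, mu.-integrable `[0, T] (fun s => (h w s)%:E)}.
Proof.
move=> mh Hz M0 hz; apply: filterS (H2_path_integrable T_ge0 W_meas Hz) => w iz.
have mhw : measurable_fun `[0, T] (h w).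
  exact: (measurable_fun_section w _ (predictable_jointly T_ge0 W_meas mh)).
apply: (@le_integrable _ _ _ mu _ _ _
  (fun s => ((c + M * d%:R)%:E + M%:E * (enorm (z w s) ^+ 2)%:E)%E)) => //.
- exact: measurableT_comp.
- move=> s /=; rewrite in_itv/= => sT; rewrite lee_fin.
  apply: (le_trans (hz w s sT)); apply: (le_trans _ (ler_norm _)).
  by rewrite -addrA lerD2l -mulrDr ler_wpM2l// norm1_le_enorm_sqr.
apply: integrableD => //; last exact: integrableZl.
apply/integrableP; split => //.
rewrite integral_cst//= lebesgue_measure_itv/= lte_fin.
by case: ifP => _; rewrite ?mule0 ?ltry// -EFinD -EFinM ltry.
Qed.

Variables (g1 g2 : Omega -> R -> 'rV[R]_d -> R).
Hypotheses (g1_meas : predictable_coef P T W g1)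
  (g2_meas : predictable_coef P T W g2)
  (g1_A1 : A1 T (lift_y g1)) (g1_A3 : A3 T (lift_y g1))
  (g2_A1 : A1 T (lift_y g2)) (g2_A3 : A3 T (lift_y g2)).

Lemma gen_predictable g z : predictable_coef P T W g -> A1 T (lift_y g) ->
  H2 P T W z -> predictable P T W (fun w t => g w t (z w t)).
Proof.
by move=> mg /A1_lipschitz[M M0 Lg] [mz _]; exact: (predictable_comp M0).
Qed.

Lemma gen_path_integrable g z : predictable_coef P T W g -> A1 T (lift_y g) ->
  A3 T (lift_y g) -> H2 P T W z ->
  {ae P, forall w, mu.-integrable `[0, T] (fun s => (g w s (z w s))%:E)}.
Proof.
move=> mg gA1 g0 Hz; have [M M0 Lg] := A1_lipschitz gA1.
apply: (@path_integrable _ z 0 M) => //; first exact: gen_predictable.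
by move=> w t tT; rewrite add0r; exact: lipschitz_gen_le.
Qed.

Variables (a : 'rV[R]_d) (b : R).
Hypotheses
  (g1_lower : forall w t u, 0 <= t <= T -> dotv a u + b <= g1 w t u)
  (g2_lower : forall w t u, 0 <= t <= T -> dotv a u + b <= g2 w t u).
Local Notation g3 := (infconv_gen g1 g2).

(** The affine minorants bound the set from below, so [inf] is a genuine infimum. *)
Lemma infconv_gen_le w t v y : 0 <= t <= T ->
  g3 w t v <= g1 w t (v - y) + g2 w t y.
Proof.
move=> tT; have [infS _] := has_inf_infconv v
  (fun u => g1_lower w u tT) (fun u => g2_lower w u tT).
by apply: ge_inf; [exact: infS.2|exists y].
Qed.

Lemma infconv_gen_argmin w t v y : 0 <= t <= T ->
  is_argmin (fun y => g1 w t (v - y) + g2 w t y) y ->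
  g3 w t v = g1 w t (v - y) + g2 w t y.
Proof.
move=> tT miny; apply/eqP; rewrite eq_le infconv_gen_le//=.
by apply: lb_le_inf; [exists (g1 w t (v - y) + g2 w t y); exists y
                     |move=> _ [u _ <-]; exact: miny].
Qed.

Lemma infconv_gen_predictable z : H2 P T W z ->
  predictable P T W (fun w t => g3 w t (z w t)).
Proof.
move=> [mz _]; have [M1 M10 L1] := A1_lipschitz g1_A1.
have [M2 M20 L2] := A1_lipschitz g2_A1.
apply: (@measurable_fun_infconv _
  (g_sigma_algebraType (predictable_gen P T W)) R d _ M1 M2
  (fun x => g1 x.1 x.2) (fun x => g2 x.1 x.2) (fun x => z x.1 x.2) a b) => //.
- by move=> x u v [_ /=]; rewrite in_itv/= => xT; exact: L1.
- by move=> x u v [_ /=]; rewrite in_itv/= => xT; exact: L2.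
- by move=> x u [_ /=]; rewrite in_itv/= => xT; exact: g1_lower.
- by move=> x u [_ /=]; rewrite in_itv/= => xT; exact: g2_lower.
Qed.

Lemma dotv_norm1 (u v : 'rV[R]_d) : `|dotv u v| <= norm1 u * norm1 v.
Proof.
apply: (le_trans (ler_norm_sum _ _ _)).
rewrite /norm1 mulr_suml; apply: ler_sum => i _; rewrite normrM ler_wpM2l//.
by rewrite (bigD1 i)//= lerDl sumr_ge0.
Qed.

(** Linear growth of g3 is enough: from below it comes from the affine minorants, from above from
    the choice y = 0, where g2 vanishes and g1 is Lipschitz. *)
Lemma infconv_gen_path_integrable z : H2 P T W z ->
  {ae P, forall w, mu.-integrable `[0, T] (fun s => (g3 w s (z w s))%:E)}.
Proof.
move=> Hz; have [M1 M10 L1] := A1_lipschitz g1_A1.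
apply: (@path_integrable _ z (2 * `|b|) (norm1 a + M1)) => //.
- exact: infconv_gen_predictable.
- by rewrite addr_ge0// norm1_ge0.
move=> w t tT; have n0 := norm1_ge0 (z w t).
have := dotv_norm1 a (z w t); rewrite ler_norml => /andP[dl du].
have := lipschitz_gen_le w (z w t) L1 g1_A3 tT; rewrite ler_norml => /andP[gl gu].
have b1 := ler_norm b; have b2 := ler_norm (- b); rewrite normrN in b2.
have a0 := mulr_ge0 (norm1_ge0 a) n0; have m0 := mulr_ge0 M10 n0.
have [_ /(lb_le_inf _)] := has_inf_infconv (z w t)
  (fun u => g1_lower w u tT) (fun u => g2_lower w u tT).
have ne : [set g1 w t (z w t - y) + g2 w t y | y in [set: 'rV[R]_d]] !=set0.
  by exists (g1 w t (z w t - 0) + g2 w t 0); exists 0.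
move=> /(_ ne); rewrite -/(g3 w t (z w t)) => lo.
have := infconv_gen_le w (z w t) 0 tT; rewrite subr0 (A3_eq0 _ g2_A3)// addr0 => hi.
by rewrite ler_norml mulrDl; apply/andP; split; lra.
Qed.

End Generators.

(** * Supersolutions *)

Section Supersolutions.
Context {disp : measure_display} {Omega : measurableType disp} {R : realType}.
Variables (P : probability Omega R) (T : R) (T_ge0 : 0 <= T).
Variables (d : nat) (W : Omega -> R -> 'rV[R]_d).
Hypothesis W_meas : forall t i, 0 <= t <= T ->
  measurable_fun setT (fun w => W w t 0 i).
Local Notation mu := (@lebesgue_measure R).
Implicit Types (g : Omega -> R -> 'rV[R]_d -> R) (z : Omega -> R -> 'rV[R]_d)
  (xi : Omega -> R) (y C I : Omega -> R -> R).

Lemma increasing_processD C C' : increasing_process P T W C ->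
  increasing_process P T W C' ->
  increasing_process P T W (fun w t => C w t + C' w t).
Proof.
move=> [aC pC] [aC' pC']; split; first exact: adaptedD.
apply: filterS2 pC pC' => w [C0 mC rC] [C0' mC' rC']; split.
- by rewrite C0 C0' addr0.
- by move=> s t s0 st tT; rewrite lerD ?mC ?mC'.
- by move=> t tT; apply: cvgD; [exact: rC|exact: rC'].
Qed.

Lemma increasing_process0 : increasing_process P T W (fun _ _ => 0).
Proof.
split; first by move=> t _; exact: measurable_cst.
by apply: aeW => w; split => // t _; exact: cvg_cst.
Qed.

Lemma increasing_process_Rintegral (k : Omega -> R -> R) :
  predictable P T W k -> (forall w t, 0 <= t <= T -> 0 <= k w t) ->
  {ae P, forall w, mu.-integrable `[0, T] (fun s => (k w s)%:E)} ->
  increasing_process P T W (fun w t => \int[mu]_(s in `[0, t]) k w s).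
Proof.
move=> pk k0 ik; split; first exact: adapted_Rintegral.
apply: filterS ik => w ik; split.
- by rewrite set_itv1 Rintegral_set1.
- by move=> s t s0 st tT; apply: (Rintegral_primitive_increasing ik) => // u; exact: k0.
- by move=> t; exact: Rintegral_primitive_right_continuous.
Qed.

Lemma supersolution_right_continuous g xi y z C :
  supersolution P T W g xi y z C ->
  {ae P, forall w t, 0 <= t < T -> y w x @[x --> t^'+] --> y w t}.
Proof.
move=> [_ _ [_ iC] ig [I [[_ _ cI _] ey]]].
apply: filterS (filterI (filterI iC ig) (filterI cI ey)).
move=> w [[[_ _ rC] igw] [cIw eyw]] t tT.
(* Rewriting the integral over [x, T] with primitives started at 0 makes every term visibly
   right-continuous in x. *)
pose F x := xi w + (\int[mu]_(s in `[0, T]) g w s (z w s) -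
  \int[mu]_(s in `[0, x]) g w s (z w s)) - (I w T - I w x) + (C w T - C w x).
have yF x : 0 <= x <= T -> y w x = F x.
  by move=> xT; rewrite eyw// /F (Rintegral_split igw xT); ring.
rewrite yF; last by case/andP: tT => -> /ltW.
apply: (@cvg_trans _ (F x @[x --> t^'+])).
  by apply: near_eq_cvg; apply: filterS (near_right_itv tT) => x /yF.
apply: cvgD; last by apply: cvgB; [exact: cvg_cst|exact: rC].
apply: cvgB; last first.
  by apply: cvgB; [exact: cvg_cst|exact: (continuous_within_right cIw)].
apply: cvgD; first exact: cvg_cst.
apply: cvgB; first exact: cvg_cst.
exact: (Rintegral_primitive_right_continuous igw).
Qed.

(** By Fubini almost every path satisfies the inequality at almost every time, and right-continuity
    extends it to all t < T. The terminal time is no limit from the right, hence the separate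
    hypothesis there. *)
Lemma dtdP_ae_le_right_continuous y y' :
  {ae P, forall w t, 0 <= t < T -> y w x @[x --> t^'+] --> y w t} ->
  {ae P, forall w t, 0 <= t < T -> y' w x @[x --> t^'+] --> y' w t} ->
  {ae P, forall w, y w T <= y' w T} ->
  dtdP_ae P T (fun w t => y w t <= y' w t) ->
  forall t, 0 <= t <= T -> {ae P, forall w, y w t <= y' w t}.
Proof.
move=> ry ry' yT /ae_product_section yy' t /andP[t0].
rewrite le_eqVlt => /predU1P[->//|tT].
apply: filterS (filterI (filterI ry ry') yy') => w [[ryw ryw'] yyw].
rewrite -subr_ge0; apply: (@right_continuous_ae_ge0 _ (fun t => y' w t - y w t) T).
- by rewrite t0.
- by apply: cvgB; [apply: ryw'|apply: ryw]; rewrite t0.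
case: yyw => N [mN N0 sN]; exists N; split => // s ns; apply: sN => /= H.
by apply: ns => /= sT; rewrite subr_ge0; exact: H.
Qed.

Lemma supersolution_terminal g xi y z C : supersolution P T W g xi y z C ->
  {ae P, forall w, y w T = xi w}.
Proof.
move=> [_ _ _ _ [I [_ ey]]]; apply: filterS ey => w -> //; last by rewrite T_ge0/=.
by rewrite set_itv1 Rintegral_set1 !subrr subr0 !addr0.
Qed.

Variables (g1 g2 : Omega -> R -> 'rV[R]_d -> R).
Hypotheses (g1_meas : predictable_coef P T W g1)
  (g2_meas : predictable_coef P T W g2)
  (g1_A1 : A1 T (lift_y g1)) (g1_A3 : A3 T (lift_y g1))
  (g2_A1 : A1 T (lift_y g2)) (g2_A3 : A3 T (lift_y g2)).
Variables (a : 'rV[R]_d) (b : R).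
Hypotheses
  (g1_lower : forall w t u, 0 <= t <= T -> dotv a u + b <= g1 w t u)
  (g2_lower : forall w t u, 0 <= t <= T -> dotv a u + b <= g2 w t u).
Local Notation g3 := (infconv_gen g1 g2).

(* The loss g1(z1) + g2(z2) - g3(z1 + z2) >= 0 is absorbed by the increasing
   process. *)
Lemma supersolution_infconvD xi xi1 xi2 y1 z1 C1 y2 z2 C2 :
  L2T P T W xi -> (forall w, xi w = xi1 w + xi2 w) ->
  supersolution P T W g1 xi1 y1 z1 C1 -> supersolution P T W g2 xi2 y2 z2 C2 ->
  exists C, supersolution P T W g3 xi (fun w t => y1 w t + y2 w t)
    (fun w t => z1 w t + z2 w t) C.
Proof.
move=> L2xi exi [_ ay1 iC1 ig1 [I1 [ito1 ey1]]] [_ ay2 iC2 ig2 [I2 [ito2 ey2]]].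
have H1 : H2 P T W z1 by case: ito1.
have H2 : Defs.H2 P T W z2 by case: ito2.
have H12 : Defs.H2 P T W (fun w t => z1 w t + z2 w t) by exact: H2D.
have ig3 := infconv_gen_path_integrable T_ge0 W_meas g1_meas g2_meas g1_A1 g1_A3
  g2_A1 g2_A3 g1_lower g2_lower H12.
pose k w t := g1 w t (z1 w t) + g2 w t (z2 w t) - g3 w t (z1 w t + z2 w t).
have pk : predictable P T W k.
  apply: predictableD; first by apply: predictableD; exact: gen_predictable.
  apply: predictableN; exact: (infconv_gen_predictable g1_meas g2_meas g1_A1
    g2_A1 g1_lower g2_lower H12).
have k0 w t : 0 <= t <= T -> 0 <= k w t.
  move=> tT; rewrite subr_ge0; have := infconv_gen_le g1_lower g2_lower w
    (z1 w t + z2 w t) (z2 w t) tT.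
  by rewrite addrK.
have mT : measurable (`[0, T] : set (measurableTypeR R)) by [].
have kE w : (fun s => (k w s)%:E) = (fun s => (g1 w s (z1 w s))%:E +
    (g2 w s (z2 w s))%:E - (g3 w s (z1 w s + z2 w s)%R)%:E)%E by [].
have ik : {ae P, forall w, mu.-integrable `[0, T] (fun s => (k w s)%:E)}.
  apply: filterS (filterI (filterI ig1 ig2) ig3) => w [[i1 i2] i3].
  rewrite kE; have i12 := @integrableD _ _ _ mu _ mT _ _ i1 i2.
  exact: (@integrableB _ _ _ mu _ mT _ _ i12 i3).
exists (fun w t => C1 w t + C2 w t + \int[mu]_(s in `[0, t]) k w s); split => //.
- exact: adaptedD.
- by apply: increasing_processD; [exact: increasing_processD|
    exact: increasing_process_Rintegral].
exists (fun w t => I1 w t + I2 w t); split; first exact: is_itoD.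
apply: filterS (filterI (filterI ey1 ey2) (filterI (filterI ig1 ig2) ig3)).
move=> w [[e1 e2] [[i1 i2] i3]] t tT; rewrite (e1 t tT) (e2 t tT) exi.
have ikw : mu.-integrable `[0, T] (fun s => (k w s)%:E).
  rewrite kE; have i12 := @integrableD _ _ _ mu _ mT _ _ i1 i2.
  exact: (@integrableB _ _ _ mu _ mT _ _ i12 i3).
rewrite (Rintegral_split ikw tT).
have sub : `[t, T] `<=` `[0, T].
  by apply: subset_itvr; rewrite bnd_simp; case/andP: tT.
have mt : measurable (`[t, T] : set (measurableTypeR R)) by [].
have j1 := integrableS mT mt sub i1.
have j2 := integrableS mT mt sub i2.
have j3 := integrableS mT mt sub i3.
have -> : \int[mu]_(s in `[t, T]) k w s = \int[mu]_(s in `[t, T]) g1 w s (z1 w s) +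
   \int[mu]_(s in `[t, T]) g2 w s (z2 w s) -
   \int[mu]_(s in `[t, T]) g3 w s (z1 w s + z2 w s).
  rewrite -RintegralD// -RintegralB//.
  exact: (@integrableD _ _ _ mu _ mt _ _ j1 j2).
ring.
Qed.

End Supersolutions.

(** * Triviality of the initial sigma-algebra *)

Section ZeroOne.
Context {disp : measure_display} {Omega : measurableType disp} {R : realType}.
Variables (P : probability Omega R) (T : R) (T_ge0 : 0 <= T).
Variables (d : nat) (W : Omega -> R -> 'rV[R]_d).

(** A null set cannot exhaust a space of mass 1. This turns almost sure relations between constants
    into plain ones. *)
Lemma ae_witness (Q : Omega -> Prop) : {ae P, forall w, Q w} -> exists w, Q w.
Proof.
move=> [N [mN N0 QN]]; apply: contrapT => nQ.
have : (P setT <= P N)%E.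
  by apply: le_measure; rewrite ?inE// => w _; apply: QN => Qw; apply: nQ; exists w.
by rewrite probability_setT N0 lee_fin ler10.
Qed.

Definition trivial_event (A : set Omega) : Prop :=
  measurable A /\ (P A = 0%E \/ P A = 1%E).

(** For countable unions: either some member has probability 1, or all are null and so is the
    union. *)
Lemma sigma_algebra_trivial_event : sigma_algebra setT trivial_event.
Proof.
split.
- by split => //; left; rewrite measure0.
- move=> A [mA PA]; rewrite setTD; split; first exact: measurableC.
  rewrite probability_setC//; case: PA => ->; [right|left].
    by rewrite sube0.
  by rewrite subee.
- move=> F mF; have mU : measurable (\bigcup_n F n).
    by apply: bigcupT_measurable => n; case: (mF n).
  split => //; have [[n Fn]|noF] := pselect (exists n, P (F n) = 1%E).
    right; apply/eqP; rewrite eq_le probability_le1//= -Fn.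
    by apply: le_measure; rewrite ?inE//; [case: (mF n)|exact: bigcup_sup].
  left; apply/negligibleP => //; apply: negligible_bigcup => n.
  have [mFn [Fn0|Fn1]] := mF n; first exact/negligibleP.
  by exfalso; apply: noF; exists n.
Qed.

(** Only time 0 enters the history, and W starts at 0 almost surely, so the preimage of B is almost
    sure or null according to whether B contains 0. *)
Lemma filtration0_trivial : brownian_motion P T W ->
  filtration P W 0 `<=` trivial_event.
Proof.
move=> bW; apply: smallest_sub; first exact: sigma_algebra_trivial_event.
move=> A [[s [i [B [s0 mB ->]]]]|[mA A0]]; last by split => //; left.
have -> : s = 0 by apply/eqP; rewrite eq_le andbC.
have mX : measurable ((fun w => W w 0 0 i) @^-1` B).
  by rewrite -[X in measurable X]setTI; apply: (bm_measurable bW); rewrite ?lexx.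
have W0 := bm_start bW.
split=> //; have [B0|B0] := pselect (B 0); [right|left].
  rewrite -[X in P X]setCK probability_setC; last exact: measurableC.
  rewrite (_ : P _ = 0%E) ?sube0//; apply/negligibleP; first exact: measurableC.
  apply: negligibleS W0 => w /= nB W0; apply: nB.
  by rewrite /= W0 mxE.
apply/negligibleP => //; apply: negligibleS W0 => w /= BW W0.
by move: BW; rewrite W0 mxE.
Qed.

(* For each rational q the event X <= q has probability 0 or 1; outside the
   countable union of the null ones among X <= q and X > q, X cannot separate
   two points. *)
Lemma rv_measurable0_cst X : brownian_motion P T W -> rv_measurable P W 0 X ->
  exists r, {ae P, forall w, X w = r}.
Proof.
move=> bW mX; pose Q (q : rat) w :=
  (P [set w | X w <= ratr q] = 0%E -> ~ X w <= ratr q) /\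
  (P [set w | X w <= ratr q] = 1%E -> X w <= ratr q).
have aeQ q : {ae P, forall w, Q q w}.
  have [mA PA] : trivial_event [set w | X w <= ratr q].
    apply: (filtration0_trivial bW); rewrite -[X in _ X]setTI.
    rewrite -preimage_itvNyc; apply: mX => //; exact: measurable_itv.
  case: PA => PA; rewrite /Q PA.
    exists [set w | X w <= ratr q]; split => // w /= nQ; apply: contrapT => nX.
    by apply: nQ; split => // /eqP; rewrite eqe eq_sym oner_eq0.
  exists (~` [set w | X w <= ratr q]); split.
  - exact: measurableC.
  - by rewrite probability_setC// PA subee.
  - move=> w /= nQ nX; apply: nQ; split => // /eqP.
    by rewrite eqe oner_eq0.
(* The rationals are enumerated by their codes, with [True] at non-codes, so one null set serves
   them all. *)
have aeX : {ae P, forall w, forall n, oapp (Q ^~ w) True (unpickle n)}.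
  by apply: ae_foralln => n; case: (unpickle n) => [q|]; [exact: aeQ|exact: aeW].
have QP w q : (forall n, oapp (Q ^~ w) True (unpickle n)) -> Q q w.
  by move=> /(_ (pickle q)); rewrite pickleK.
have not_lt w w' : (forall n, oapp (Q ^~ w) True (unpickle n)) ->
    (forall n, oapp (Q ^~ w') True (unpickle n)) -> ~ X w < X w'.
  (* For q strictly between the two values, X <= q holds at w and fails at w', so its probability
     can be neither 0 nor 1. *)
  move=> Qw Qw' /rat_in_itvoo[q]; rewrite in_itv/= => /andP[wq qw'].
  have [mA [PA|PA]] : trivial_event [set w | X w <= ratr q].
    apply: (filtration0_trivial bW); rewrite -[X in _ X]setTI.
    rewrite -preimage_itvNyc; apply: mX => //; exact: measurable_itv.
  - by case: (QP _ q Qw) => + _; apply => //; exact: ltW.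
  - by case: (QP _ q Qw') => _ /(_ PA); rewrite leNgt qw'.
have [w0 Qw0] := ae_witness aeX.
exists (X w0); apply: filterS aeX => w Qw; apply/eqP.
by rewrite eq_le !leNgt; apply/andP; split; apply/negP; exact: not_lt.
Qed.

Lemma Linf_L2T X : Linf P T W X -> measurable_fun setT X -> L2T P T W X.
Proof.
move=> [mX [M XM]] mX'; split => //.
apply: (@le_lt_trans _ _ (\int[P]_w (M ^+ 2)%:E)%E).
  apply: ae_ge0_le_integral => //.
  - by move=> w _; rewrite lee_fin sqr_ge0.
  - by apply: measurableT_comp => //; exact: measurable_funX.
  - by move=> w _; rewrite lee_fin sqr_ge0.
  apply: filterS XM => w XM _; rewrite lee_fin -(real_normK (num_real (X w))).
  by rewrite ler_sqr ?nnegrE// (le_trans _ XM).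
by rewrite integral_cst//= probability_setT mule1 ltry.
Qed.

Lemma LinfD X Y : Linf P T W X -> Linf P T W Y ->
  Linf P T W (fun w => X w + Y w).
Proof.
move=> [mX [M XM]] [mY [M' YM]]; split; first exact: measurable_funD.
exists (M + M'); apply: filterS2 XM YM => w XM YM.
by rewrite (le_trans (ler_normD _ _))// lerD.
Qed.

Lemma LinfN X : Linf P T W X -> Linf P T W (\- X).
Proof.
move=> [mX [M XM]]; split; first exact: measurableT_comp.
by exists M; apply: filterS XM => w; rewrite normrN.
Qed.

End ZeroOne.

(** * Splitting a supersolution along a given integrand *)

Section Splitting.
Context {disp : measure_display} {Omega : measurableType disp} {R : realType}.
Variables (P : probability Omega R) (T : R) (T_ge0 : 0 <= T).
Variables (d : nat) (W : Omega -> R -> 'rV[R]_d).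
Hypothesis W_meas : forall t i, 0 <= t <= T ->
  measurable_fun setT (fun w => W w t 0 i).
Local Notation mu := (@lebesgue_measure R).
Variables (g : Omega -> R -> 'rV[R]_d -> R)
  (zhat : Omega -> R -> 'rV[R]_d) (Ihat : Omega -> R -> R).
Hypotheses (g_meas : predictable_coef P T W g) (g_A1 : A1 T (lift_y g))
  (g_A3 : A3 T (lift_y g)) (ito_hat : is_ito P T W zhat Ihat).

(** The solution of dy = - g(t, zhat) dt + zhat dW. For g = g2 its value at T is - xistar. *)
Definition forward_process w t : R :=
  Ihat w t - \int[mu]_(s in `[0, t]) g w s (zhat w s).

Lemma adapted_forward_process : adapted P T W forward_process.
Proof.
have [Hz aI _ _] := ito_hat; apply: adaptedD => //; apply: adaptedN.
by apply: adapted_Rintegral => //; exact: gen_predictable.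
Qed.

Lemma supersolution_forward_process : L2T P T W (forward_process ^~ T) ->
  supersolution P T W g (forward_process ^~ T) forward_process zhat
    (fun _ _ => 0).
Proof.
move=> L2xi; have [Hz _ _ _] := ito_hat.
have ig := gen_path_integrable T_ge0 W_meas g_meas g_A1 g_A3 Hz.
split => //; [exact: adapted_forward_process|exact: increasing_process0|].
exists Ihat; split => //; apply: filterS ig => w ig t tT.
by rewrite /forward_process (Rintegral_split ig tT); ring.
Qed.

(** When G splits as h + g along z and zhat, subtracting the forward process leaves exactly the
    driver h at z - zhat, and the increasing process C is unchanged. *)
Lemma supersolutionB (G h : Omega -> R -> 'rV[R]_d -> R) eta y z C xi :
  predictable_coef P T W h -> A1 T (lift_y h) -> A3 T (lift_y h) ->
  (forall w, xi w = eta w - forward_process w T) -> L2T P T W xi ->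
  dtdP_ae P T (fun w t => G w t (z w t) = h w t (z w t - zhat w t) + g w t (zhat w t)) ->
  supersolution P T W G eta y z C ->
  supersolution P T W h xi (fun w t => y w t - forward_process w t)
    (fun w t => z w t - zhat w t) C.
Proof.
move=> mh hA1 hA3 exi L2xi eG [_ ay iC iG [I [ito ey]]].
have [Hz _ _ _] := ito_hat; have [Hz' _ _ _] := ito.
have ito' := is_itoD T_ge0 W_meas ito (is_itoN ito_hat).
have [Hd _ _ _] := ito'.
have ig := gen_path_integrable T_ge0 W_meas g_meas g_A1 g_A3 Hz.
have ih := gen_path_integrable T_ge0 W_meas mh hA1 hA3 Hd.
split => //.
  by apply: adaptedD => //; apply: adaptedN; exact: adapted_forward_process.
exists (fun w t => I w t - Ihat w t); split => //.
have eG' := ae_product_section eG.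
apply: filterS (filterI (filterI ey eG') (filterI (filterI ig ih) iG)).
move=> w [[eyw eGw] [[igw ihw] iGw]] t tT.
have sub : `[t, T] `<=` `[0, T].
  by apply: subset_itvr; rewrite bnd_simp; case/andP: tT.
have mT : measurable (`[0, T] : set (measurableTypeR R)) by [].
have mt : measurable (`[t, T] : set (measurableTypeR R)) by [].
have jg := integrableS mT mt sub igw.
have jh := integrableS mT mt sub ihw.
have jG := integrableS mT mt sub iGw.
have -> : \int[mu]_(s in `[t, T]) h w s (z w s - zhat w s) =
    \int[mu]_(s in `[t, T]) G w s (z w s) - \int[mu]_(s in `[t, T]) g w s (zhat w s).
  have -> : \int[mu]_(s in `[t, T]) G w s (z w s) =
      \int[mu]_(s in `[t, T]) (h w s (z w s - zhat w s) + g w s (zhat w s)).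
    (* The splitting of G holds for almost every time only, which the integral does not see. *)
    congr fine; apply: ae_eq_integral => //.
    - exact: measurable_int jG.
    - exact: (measurable_int _ (@integrableD _ _ _ mu _ mt _ _ jh jg)).
    - case: eGw => N [mN N0 sN]; exists N; split => // s ns; apply: sN => /= H.
      apply: ns => /=; rewrite in_itv/= => /andP[ts sT]; rewrite H// sT andbT.
      by case/andP: tT => t0 _; exact: le_trans ts.
  by rewrite RintegralD//; ring.
rewrite (eyw t tT) exi /forward_process (Rintegral_split igw tT); ring.
Qed.

End Splitting.

(** * Almost-everywhere reasoning on the time strip, and the assembly of the two statements *)

Lemma dtdP_ae_filterS2 (disp : measure_display) (Omega : measurableType disp)
    (R : realType) (P : probability Omega R) (T : R)
    (Q1 Q2 Q : Omega -> R -> Prop) :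
  (forall w t, 0 <= t <= T -> Q1 w t -> Q2 w t -> Q w t) ->
  dtdP_ae P T Q1 -> dtdP_ae P T Q2 -> dtdP_ae P T Q.
Proof.
have F := ae_filter_ringOfSetsType (P \x (@lebesgue_measure R))%E.
move=> H; apply: (@filterS2 _ _ F) => -[w t] /= q1 q2 tT.
by apply: H => //; [exact: q1|exact: q2].
Qed.

Lemma dtdP_ae_filterS (disp : measure_display) (Omega : measurableType disp)
    (R : realType) (P : probability Omega R) (T : R)
    (Q1 Q : Omega -> R -> Prop) :
  (forall w t, 0 <= t <= T -> Q1 w t -> Q w t) ->
  dtdP_ae P T Q1 -> dtdP_ae P T Q.
Proof. by move=> H q1; apply: (dtdP_ae_filterS2 _ q1 q1) => w t tT + _; exact: H. Qed.

Theorem theorem3p7 (disp : measure_display) (Omega : measurableType disp)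
  (R : realType) (P : probability Omega R) (T : R) (T_gt0 : 0 < T)
  (d : nat) (W : Omega -> R -> 'rV[R]_d) (W_bm : brownian_motion P T W)
  (g1 g2 : Omega -> R -> 'rV[R]_d -> R) (phi : R -> 'rV[R]_d -> R)
  (g1_meas : predictable_coef P T W g1) (g2_meas : predictable_coef P T W g2)
  (phi_ge0 : forall t z, 0 <= t <= T -> 0 <= phi t z)
  (g1_convex : forall w t, 0 <= t <= T -> convex_function setT (g1 w t))
  (g2_convex : forall w t, 0 <= t <= T -> convex_function setT (g2 w t))
  (phi_convex : forall t, 0 <= t <= T -> convex_function setT (phi t))
  (g1_A1 : A1 T (lift_y g1)) (g1_A2 : A2 P T W (lift_y g1))
  (g1_A3 : A3 T (lift_y g1))
  (g2_A1 : A1 T (lift_y g2)) (g2_A2 : A2 P T W (lift_y g2))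
  (g2_A3 : A3 T (lift_y g2))
  (phi_A1 : A1 T (lift_y (fun _ : Omega => phi)))
  (phi_A2 : A2 P T W (lift_y (fun _ : Omega => phi)))
  (phi_A3 : A3 T (lift_y (fun _ : Omega => phi)))
  (phi_subadd : forall t z1 z2, 0 <= t <= T ->
     phi t (z1 + z2) <= phi t z1 + phi t z2)
  (a : 'rV[R]_d) (b : R)
  (g1_lower : forall w t z, 0 <= t <= T -> dotv a z + b <= g1 w t z)
  (g2_lower : forall w t z, 0 <= t <= T -> dotv a z + b <= g2 w t z)
  (eta : Omega -> R) (eta_Linf : Linf P T W eta)
  (y3 : Omega -> R -> R) (z3 : Omega -> R -> 'rV[R]_d) (C3 : Omega -> R -> R)
  (sol3 : gGamma_solution P T W (infconv_gen g1 g2) phi eta y3 z3 C3)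
  (zhat : Omega -> R -> 'rV[R]_d) (zhat_meas : jointly_measurable T zhat)
  (zhat_argmin : dtdP_ae P T (fun w t =>
     is_argmin (fun y => g1 w t (z3 w t - y) + g2 w t y) (zhat w t))) :
  (forall t, 0 <= t <= T -> forall xi, Linf P T W xi ->
     forall y1 y2, gGamma_expectation P T W g1 phi (eta \- xi) y1 ->
       gGamma_expectation P T W g2 phi xi y2 ->
       {ae P, forall w, y3 w t <= y1 w t + y2 w t})
  /\
  (satisfies_constraint P T phi zhat ->
   satisfies_constraint P T phi (fun w t => z3 w t - zhat w t) ->
   forall Ihat, is_ito P T W zhat Ihat ->
   let xistar := fun w =>
     (\int[lebesgue_measure]_(s in `[0, T]) g2 w s (zhat w s)) - Ihat w T in
   Linf P T W xistar ->
   optimal_transfer P T W (risk_measure P T W g1 phi)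
     (risk_measure P T W g2 phi) (\- eta) xistar
   /\
   forall t, 0 <= t <= T ->
     is_infconv P T W g1 g2 phi t eta (fun w => y3 w t)).
Proof.
have T0 := ltW T_gt0; have W_meas := bm_measurable W_bm.
have [sup3 _ min3] := sol3.
have L2eta : L2T P T W eta by case: sup3.
have TT : 0 <= T <= T by rewrite T0 lexx.
(* Stated for arbitrary constrained supersolutions rather than minimal ones, so that it gives both
   the lower bound and the minimality of the two summands constructed later. *)
have le_sum xi1 xi2 y1 z1 C1 y2 z2 C2 : (forall w, eta w = xi1 w + xi2 w) ->
    supersolution P T W g1 xi1 y1 z1 C1 -> satisfies_constraint P T phi z1 ->
    supersolution P T W g2 xi2 y2 z2 C2 -> satisfies_constraint P T phi z2 ->
    dtdP_ae P T (fun w t => y3 w t <= y1 w t + y2 w t).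
  move=> exi s1 c1 s2 c2.
  have [C s12] := supersolution_infconvD T0 W_meas g1_meas g2_meas g1_A1 g1_A3
    g2_A1 g2_A3 g1_lower g2_lower L2eta exi s1 s2.
  apply: min3 s12 _; apply: dtdP_ae_filterS2 c1 c2 => w t tT c1 c2.
  (* Subadditivity bounds phi at the sum by 0, and nonnegativity of phi forces equality. *)
  apply/eqP; rewrite eq_le phi_ge0// andbT (le_trans (phi_subadd _ _ _ tT))//.
  by rewrite c1 c2 addr0.
have part1 t : 0 <= t <= T -> forall xi y1 y2,
    gGamma_expectation P T W g1 phi (eta \- xi) y1 ->
    gGamma_expectation P T W g2 phi xi y2 ->
    {ae P, forall w, y3 w t <= y1 w t + y2 w t}.
  move=> tT xi y1 y2 [z1 [C1 [s1 c1 _]]] [z2 [C2 [s2 c2 _]]].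
  have exi w : eta w = (eta \- xi) w + xi w by rewrite /= subrK.
  (* At T both sides equal eta almost surely; earlier times follow from right-continuity. *)
  apply: (dtdP_ae_le_right_continuous (y' := fun w t => y1 w t + y2 w t)
    _ _ _ (le_sum _ _ _ _ _ _ _ _ exi s1 c1 s2 c2) tT).
  - exact: supersolution_right_continuous sup3.
  - apply: filterS2 (supersolution_right_continuous s1)
      (supersolution_right_continuous s2) => w r1 r2 u uT.
    by apply: cvgD; [exact: r1|exact: r2].
  - apply: filterS (filterI (supersolution_terminal T0 sup3)
      (filterI (supersolution_terminal T0 s1) (supersolution_terminal T0 s2))).
    by move=> w [-> [-> ->]]; rewrite -exi.
split; first by move=> t tT xi _ y1 y2; exact: part1.
move=> c2 c1 Ihat ito_hat xistar Lxistar.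
pose y2 := forward_process g2 zhat Ihat; pose y1 w t := y3 w t - y2 w t.
pose z1 w t := z3 w t - zhat w t.
(* Since [risk_measure] changes the sign, the terminal value given to g2 is - xistar and the one
   given to g1 is eta + xistar. *)
have exi2 : \- xistar = y2 ^~ T by apply/funext => w; rewrite /= opprB.
have Lmxi : Linf P T W (\- xistar) by exact: LinfN.
have exi1 : eta \- (\- xistar) = (fun w => eta w - y2 w T) by rewrite exi2.
have Lxi1 : Linf P T W (eta \- (\- xistar)).
  by apply: LinfD => //; exact: LinfN.
have L2 X : Linf P T W X -> L2T P T W X.
  move=> LX; have [mX _] := LX.
  exact: (Linf_L2T LX (rv_measurableT W_meas TT mX)).
have sup2 : supersolution P T W g2 (\- xistar) y2 zhat (fun _ _ => 0).
  rewrite exi2; apply: supersolution_forward_process => //.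
  by rewrite -/y2 -exi2; exact: L2.
(* The argmin property is the splitting g3(z3) = g1(z3 - zhat) + g2(zhat); the whole of [C3] goes to
   the first summand. *)
have sup1 : supersolution P T W g1 (eta \- (\- xistar)) y1 z1 C3.
  apply: (supersolutionB T0 W_meas g2_meas g2_A1 g2_A3 ito_hat g1_meas g1_A1 g1_A3
    _ _ _ sup3).
  - by move=> w; rewrite exi1.
  - exact: L2.
  - apply: dtdP_ae_filterS zhat_argmin => w t tT amin.
    exact: (infconv_gen_argmin g1_lower g2_lower).
have exi w : eta w = (eta \- (\- xistar)) w + (\- xistar) w by rewrite /= subrK.
have exp2 : gGamma_expectation P T W g2 phi (\- xistar) y2.
  exists zhat, (fun _ _ => 0); split => // y' z' C' s' c'.
  apply: dtdP_ae_filterS (le_sum _ _ _ _ _ _ _ _ exi sup1 c1 s' c') => w t tT.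
  by rewrite /y1 -addrA lerDl addrC subr_ge0.
have exp1 : gGamma_expectation P T W g1 phi (eta \- (\- xistar)) y1.
  exists z1, C3; split => // y' z' C' s' c'.
  apply: dtdP_ae_filterS (le_sum _ _ _ _ _ _ _ _ exi s' c' sup2 c2) => w t tT.
  by rewrite /y1 lerBlDr.
have OT : 0 <= (0 : R) <= T by rewrite lexx T0.
have [[_ ay1 _ _ _] [_ ay2 _ _ _] [_ ay3 _ _ _]] := And3 sup1 sup2 sup3.
split.
  (* The risk measures are real numbers because the values at time 0 are almost surely constant. *)
  have [r1 r1P] := rv_measurable0_cst T0 W_bm (ay1 _ OT).
  have [r2 r2P] := rv_measurable0_cst T0 W_bm (ay2 _ OT).
  split => //; exists r1, r2; split.
  - exists y1 => //; rewrite (_ : \- _ = eta \- (\- xistar))//.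
    by apply/funext => w /=; ring.
  - by exists y2.
  move=> xi' s1 s2 Lxi' [y1' e1 y1s] [y2' e2 y2s].
  (* With X = - eta, the terminal value - (X - xi') is eta - (- xi'), the form that the lower bound
     expects. *)
  have e1' : gGamma_expectation P T W g1 phi (eta \- (\- xi')) y1'.
    rewrite (_ : _ \- _ = \- (\- eta \- xi'))//.
    by apply/funext => w /=; ring.
  (* A single outcome where all four constants are attained and the lower bound holds yields the
     inequality between reals. *)
  have [w [[[p1 p2] [q1 q2]] le]] := ae_witness (filterI (filterI
    (filterI r1P r2P) (filterI y1s y2s)) (part1 _ OT _ _ _ e1' e2)).
  by move: le; rewrite q1 q2 -p1 -p2 /y1 subrK.
move=> t tT; split.
- exact: (rv_measurableT W_meas tT (ay3 _ tT)).
- by move=> _ [xi [u1 [u2 [_ e1 e2 ->]]]]; exact: part1 e1 e2.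
- move=> X' mX' X'le.
  (* The pair [y1], [y2] belongs to the family and sums to [y3], so any lower bound of the family
     lies below [y3]. *)
  have : {ae P, forall w, X' w <= y1 w t + y2 w t}.
    by apply: X'le; exists (\- xistar), y1, y2.
  by apply: filterS => w; rewrite /y1 subrK.
Qed.
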